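(* Let $\Omega\subsetneq\mathbb{R}^n$ be open, such that $-\Delta d\ge0$ in $\Omega$ in the sense of distributions, and such that $R:=\sup_{x\in\Omega}d(x)<\infty$. For all $u\in C_c^\infty(\Omega)$, all $s\ge1$ and all $\gamma>1$, $$\int_\Omega\frac{|\nabla u|}{d^{s-1}}dx\ \ge\ (s-1)\int_\Omega\frac{|u|}{d^s}dx+\frac{C}{R^{s-1}}\int_\Omega\frac{|u|}{d}X^\gamma\Big(\frac dR\Big)dx$$ holds with a constant $C\ge\gamma-1$.
   Context: $d(x):=\operatorname{dist}(x,\mathbb{R}^n\setminus\Omega)$; $X(t):=(1-\log t)^{-1}$ for $t\in(0,1]$. *)

(* Defs.v *)
From HB Require Import structures.
From mathcomp Require Import all_boot all_order all_algebra.
From mathcomp Require Import all_classical all_reals all_analysis.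
Set Implicit Arguments. Unset Strict Implicit. Unset Printing Implicit Defensive.
Import Order.TTheory GRing.Theory Num.Theory.
Import numFieldNormedType.Exports.
Local Open Scope classical_set_scope.
Local Open Scope ring_scope.

Section Defs.
Variables (R : realType) (n : nat).
Notation V := 'rV[R]_n.

(* Euclidean norm on R^n (the library norm on 'rV is the sup norm). *)
Definition enorm (v : V) : R := Num.sqrt (\sum_(i < n) v ord0 i ^+ 2).

Definition distc (Om : set V) (x : V) : R :=
  inf [set enorm (x - y) | y in ~` Om].

Definition partial (i : 'I_n) (f : V -> R) : V -> R :=
  fun x => 'D_(delta_mx ord0 i : V) f x.

Fixpoint iter_partial (s : seq 'I_n) (f : V -> R) : V -> R :=
  match s with
  | [::] => f
  | i :: s' => partial i (iter_partial s' f)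
  end.

Definition smooth (f : V -> R) : Prop :=
  (forall (s : seq 'I_n) (i : 'I_n) (x : V),
      derivable (iter_partial s f) x (delta_mx ord0 i : V)) /\
  (forall s : seq 'I_n, continuous (iter_partial s f)).

Definition Cc_infty (Om : set V) (f : V -> R) : Prop :=
  smooth f /\ compact (closure [set x | f x != 0]) /\
  closure [set x | f x != 0] `<=` Om.

Definition gradnorm (f : V -> R) (x : V) : R :=
  Num.sqrt (\sum_(i < n) (partial i f x) ^+ 2).

Definition laplacian (f : V -> R) (x : V) : R :=
  \sum_(i < n) partial i (partial i f) x.

(* Lebesgue integral on R^n, as the iterated one-dimensional Lebesgue
   integral over the coordinates (Fubini/Tonelli). *)
Fixpoint iint (k : nat) (g : seq R -> \bar R) : \bar R :=
  match k with
  | 0%N => g [::]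
  | k'.+1 => (\int[@lebesgue_measure R]_(t in [set: R])
               iint k' (fun s => g (t :: s)))%E
  end.

Definition intRn (f : V -> \bar R) : \bar R :=
  iint n (fun s => f (\row_(i < n) nth 0 s i)).

Definition neg_laplacian_nonneg (Om : set V) (g : V -> R) : Prop :=
  forall phi : V -> R, Cc_infty Om phi -> (forall x, 0 <= phi x) ->
    (intRn (fun x => (g x * laplacian phi x)%:E) <= 0)%E.

End Defs.

Definition Xfun (R : realType) (t : R) : R := (1 - ln t)^-1.

(* Main.v *)
(* If F is decreasing and nonnegative on (0, R], then formally, since |grad d| = 1,
   -div (F(d) grad d) = -F'(d) - F(d) Delta d >= -F'(d), and testing with |u| gives
   int F(d) |grad u| >= int (-F'(d)) |u|.  The choice
   F(t) = t^(1-s) - R^(1-s) X(t/R)^(gamma-1) satisfies 0 <= F(t) <= t^(1-s) and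
   -F'(t) = (s-1) t^(-s) + (gamma-1) R^(1-s) X(t/R)^gamma / t, which is the claim
   with C = gamma - 1.

   To make the formal step rigorous, d is replaced by a mollification P, which is
   smooth and superharmonic near the support of u.  That |grad P| is close to 1 in
   the mean comes from semiconcavity: at every point d has an approximate
   superdifferential p with |p| = 1, and each p_i as well as each d_i P lies between
   the forward and the backward difference quotient of d up to a small error, while
   the gap between these two quotients has small weighted integral by translation
   invariance.  Thus no differentiability of d is ever used. *)
Require Import Defs.
From HB Require Import structures.
From mathcomp Require Import all_boot all_order all_algebra.
From mathcomp Require Import all_classical all_reals all_analysis.
From mathcomp Require Import ring lra.
Import Order.TTheory GRing.Theory Num.Theory.
Import numFieldNormedType.Exports.
Set Implicit Arguments. Unset Strict Implicit. Unset Printing Implicit Defensive.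
Local Open Scope classical_set_scope.
Local Open Scope ring_scope.

(** * One-dimensional integrals of continuous compactly supported functions *)

Section OneDim.
Variable R : realType.
Notation mu := (@lebesgue_measure R).
Implicit Types (f g : R -> R) (K M : R).

(** The weight is found by integrating the wanted remainder: [X(t/R)] has derivative [X^2/t], so
    [(gamma-1) X^gamma / t] has primitive [X^(gamma-1)]. The coefficient [R^(1-s)] is the largest
    one for which [F(R)] is still nonnegative, since [X = 1] at [t = R].

    Integrals over R^n are iterated one-dimensional integrals. The work is therefore done with
    continuous compactly supported functions, for which every inner integral is again of this kind
    and every limit is a uniform estimate. To stay in this class, [d] is cut off below by a level
    [m] with [4 m <= d] on the support of [u], and [|u|] is smoothed.

    The obstacle is that [grad P] need not be near a unit vector at a given point: the bound for its
    distance to [p] is a second difference of [d] divided by the step [h], which stays of order one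
    across a ridge of [d]. It becomes small only after integration against a continuous weight, onto
    which the translation is moved. Mollifying with radius [r] perturbs a quotient of step [h] by a
    multiple of [r/h], so [h] is fixed before [r]. *)

Definition ccont K f := continuous f /\ forall t, K < `|t| -> f t = 0.

Lemma ccont_restrict K f : ccont K f -> f = f \_ `[- K, K].
Proof.
move=> [_ f0]; apply/funext => t; rewrite /patch; case: ifPn => // tK.
apply: f0; move: tK; rewrite notin_setE/= in_itv/= => /negP.
by rewrite -ler_norml -ltNge.
Qed.

Lemma ccont_integrable K f : ccont K f -> mu.-integrable setT (EFin \o f).
Proof.
move=> fK; rewrite (ccont_restrict fK) -restrict_EFin.
apply/integrable_restrict => //=; rewrite setTI.
apply: continuous_compact_integrable; first exact: segment_compact.
by apply: continuous_subspaceT; case: fK.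
Qed.

Lemma integral_ccont K f : ccont K f ->
  (\int[mu]_t (f t)%:E)%E = (\int[mu]_t f t)%R%:E.
Proof.
move=> fK; rewrite /Rintegral fineK//.
by apply: integrable_fin_num => //; exact: ccont_integrable fK.
Qed.

Lemma Rintegral_ccont_itv K a b f : ccont K f -> a <= - K -> K <= b ->
  (\int[mu]_t f t = \int[mu]_(t in `[a, b]) f t)%R.
Proof.
move=> [_ f0] aK Kb; rewrite [RHS]Rintegral_mkcond; apply: eq_Rintegral => t _.
rewrite /patch; case: ifPn => //; rewrite notin_setE/= in_itv/= => tab.
apply: f0; rewrite ltNge ler_norml; apply: contra_notN tab => /andP[? ?].
by apply/andP; split; lra.
Qed.

Lemma ccont_shift K f a : ccont K f -> ccont (K + `|a|) (fun t => f (t + a)).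
Proof.
move=> [cf f0]; split.
  move=> t; apply: continuous_comp; last exact: cf.
  by apply: cvgD; [exact: cvg_id|exact: cvg_cst].
move=> t Kt; apply: f0.
have := ler_normB (t + a) a; rewrite addrK; lra.
Qed.

Lemma Rintegral_shift K f a : ccont K f ->
  (\int[mu]_t f (t + a) = \int[mu]_t f t)%R.
Proof.
(* The interval with end points [- L - |a|] and [L + |a|] contains the support of the shifted
   function, and its translate by [a] contains that of [f]. The absolute value of [K] keeps the end
   points ordered even for negative [K]. *)
move=> fK; pose L := `|K| + `|a|.
have la : `|a| <= L by rewrite /L lerDr.
have KL : K <= L - `|a| by rewrite /L addrK ler_norm.
have aa := ler_norm a; have aaN : - a <= `|a| by rewrite -normrN ler_norm.
have a0 := normr_ge0 a.
rewrite (@Rintegral_ccont_itv _ (- L - `|a|) (L + `|a|) _ (ccont_shift a fK)); [|lra..].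
rewrite (@Rintegral_ccont_itv _ (- L - `|a| + a) (L + `|a| + a) _ fK); [|lra..].
have D1 : derive1 (fun t : R => t + a) = cst 1.
  by apply/funext => z; rewrite derive1E derive_val addr0.
rewrite /Rintegral; congr fine.
rewrite (@integration_by_substitution_increasing _ (fun t => t + a) f) //=.
- by apply: eq_integral => x _; rewrite D1 !fctE mulr1.
- lra.
- by move=> x y _ _; rewrite ltrD2r.
- by rewrite D1 => ? _; exact: cvg_cst.
- by rewrite D1; exact: is_cvg_cst.
- by rewrite D1; exact: is_cvg_cst.
- split.
  + by move=> x _; apply: ex_derive.
  + by apply: cvgD; [exact: cvg_at_right_filter cvg_id|exact: cvg_cst].
  + by apply: cvgD; [exact: cvg_at_left_filter cvg_id|exact: cvg_cst].
- by apply: continuous_subspaceT; case: fK.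
Qed.

Lemma ccont_le K f g : ccont K f -> ccont K g -> (forall t, f t <= g t) ->
  (\int[mu]_t f t <= \int[mu]_t g t)%R.
Proof.
move=> fK gK fg; apply: le_Rintegral => //.
  exact: ccont_integrable fK.
exact: ccont_integrable gK.
Qed.

Lemma ccont_lin K f g a : ccont K f -> ccont K g ->
  (\int[mu]_t (a * f t + g t) = a * \int[mu]_t f t + \int[mu]_t g t)%R.
Proof.
move=> fK gK.
have fi := ccont_integrable fK; have gi := ccont_integrable gK.
rewrite RintegralD ?RintegralZl //.
by rewrite (_ : EFin \o _ = fun t => (a%:E * (f t)%:E)%E)//; exact: integrableZl.
Qed.

Lemma Rintegral_itv_cst K c : 0 <= K -> (\int[mu]_(t in `[- K, K]) c = c * (2 * K))%R.
Proof.
move=> K0; rewrite Rintegral_cst//= lebesgue_measure_itv/= lte_fin.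
case: ltP => /= H; first by rewrite opprK; congr (_ * _); lra.
have K00 : K = 0 by lra.
by rewrite K00 !mulr0.
Qed.

Lemma ccont_bound K f M : 0 <= K -> ccont K f -> (forall t, `|f t| <= M) ->
  `|(\int[mu]_t f t)%R| <= M * (2 * K).
Proof.
move=> K0 fK fM; rewrite (Rintegral_ccont_itv fK (lexx _) (lexx _)).
have fi : mu.-integrable `[- K, K] (EFin \o f).
  apply: continuous_compact_integrable; first exact: segment_compact.
  by apply: continuous_subspaceT; case: fK.
apply: le_trans (le_normr_Rintegral _ fi) _ => //.
rewrite -Rintegral_itv_cst//; apply: le_Rintegral => //.
  apply: continuous_compact_integrable; first exact: segment_compact.
  apply: continuous_subspaceT => t.
  by apply: cvg_norm; case: fK => cf _; exact: cf.
apply: continuous_compact_integrable; first exact: segment_compact.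
by apply: continuous_subspaceT => t; exact: cvg_cst.
Qed.

Lemma ccont_lower K f e c : 0 <= e -> 0 <= c -> ccont K f ->
  (forall t, 0 <= f t) -> (forall t, `|t| <= e -> c <= f t) ->
  c * (2 * e) <= (\int[mu]_t f t)%R.
Proof.
move=> e0 c0 fK f0 fc; pose L := Num.max K e.
have KL : K <= L by rewrite /L le_max lexx.
have eL : e <= L by rewrite /L le_max lexx orbT.
have fi a b : mu.-integrable `[a, b] (EFin \o f).
  apply: continuous_compact_integrable; first exact: segment_compact.
  by apply: continuous_subspaceT; case: fK.
rewrite -Rintegral_itv_cst// Rintegral_mkcond.
rewrite (Rintegral_ccont_itv fK (_ : - L <= - K) KL) ?lerN2//.
rewrite [leRHS]Rintegral_mkcond; apply: le_Rintegral => //.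
- rewrite -restrict_EFin; apply/integrable_restrict => //=; rewrite setTI.
  apply: continuous_compact_integrable; first exact: segment_compact.
  by apply: continuous_subspaceT => t; exact: cvg_cst.
- by rewrite -restrict_EFin; apply/integrable_restrict => //=; rewrite setTI.
move=> t _; rewrite /patch.
case: ifPn => [/set_mem/=|_]; last by case: ifP.
rewrite in_itv/= -ler_norml => te; rewrite ifT ?fc//.
by apply/mem_set; rewrite /= in_itv/= -ler_norml (le_trans te).
Qed.

End OneDim.

(** * Iterated integrals over sequences *)

Section SeqIntegral.
Variable R : realType.
Notation mu := (@lebesgue_measure R).
Implicit Types (f g : seq R -> R) (K M : R).

(** Real-valued counterpart of [iint], on which linear arithmetic is possible; [iint_rint]
    identifies the two on the class [uccont]. *)
Fixpoint rint k g : R :=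
  match k with
  | 0%N => g [::]
  | k'.+1 => (\int[mu]_t rint k' (fun s => g (t :: s)))%R
  end.

(** Uniform continuity is what survives integration in one variable: a modulus common to all slices
    passes to the integral of the slices. Only sequences of length [k] are constrained, since only
    these are read by [rint k]. *)
Definition uccont k K g :=
  (forall s, size s = k -> has (fun t => K < `|t|) s -> g s = 0) /\
  (forall e, 0 < e -> exists2 d, 0 < d & forall s s', size s = k -> size s' = k ->
     (forall i, (i < k)%N -> `|s`_i - s'`_i| < d) -> `|g s - g s'| <= e).

Definition sadd (a s : seq R) := [seq x.1 + x.2 | x <- zip s a].

Lemma nth_sadd k a s i : size a = k -> size s = k -> (i < k)%N ->
  (sadd a s)`_i = s`_i + a`_i.
Proof.
move=> ak sk ik; rewrite (nth_map (0, 0)) ?size_zip ?ak ?sk ?minnn//.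
by rewrite nth_zip ?ak ?sk.
Qed.

Lemma rint_ext k f g : (forall s, size s = k -> f s = g s) -> rint k f = rint k g.
Proof.
elim: k f g => [|k IH] f g fg /=; first exact: fg.
apply: eq_Rintegral => t _; apply: IH => s sk; apply: fg.
by rewrite /= sk.
Qed.

Lemma uccont_slice k K g t : uccont k.+1 K g -> uccont k K (fun s => g (t :: s)).
Proof.
move=> [g0 gc]; split=> [s sk Ks|e e0]; first by apply: g0; rewrite /= ?sk ?Ks ?orbT.
have [d d0 H] := gc e e0; exists d => // s s' sk s'k ss'.
by apply: H; rewrite /= ?sk ?s'k// => -[|i] /= ik; [rewrite subrr normr0|exact: ss'].
Qed.

Lemma uccont_lin k K f g a : uccont k K f -> uccont k K g ->
  uccont k K (fun s => a * f s + g s).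
Proof.
move=> [f0 fc] [g0 gc]; split=> [s sk Ks|e e0].
  by rewrite f0 ?g0// mulr0 addr0.
have e1 : 0 < e / 2 / (`|a| + 1) by apply: divr_gt0; [exact: divr_gt0|exact: ltr_wpDl].
have [d1 d10 H1] := fc _ e1.
have [d2 d20 H2] := gc _ (divr_gt0 e0 (ltr0n R 2)).
exists (Num.min d1 d2) => [|s s' sk s'k ss']; first by rewrite lt_min d10.
have {}H1 : `|f s - f s'| <= e / 2 / (`|a| + 1).
  by apply: H1 => // i /ss'; rewrite lt_min => /andP[].
have {}H2 : `|g s - g s'| <= e / 2.
  by apply: H2 => // i /ss'; rewrite lt_min => /andP[].
rewrite (_ : _ - _ = a * (f s - f s') + (g s - g s')); last by ring.
rewrite (splitr e) (le_trans (ler_normD _ _))// lerD// normrM.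
move: H1; rewrite ler_pdivlMr ?ltr_wpDl// mulrDr mulr1 mulrC.
by apply: le_trans; rewrite lerDl.
Qed.

Lemma uccont_cst0 k K : uccont k K (fun=> 0).
Proof. by split=> // e e0; exists 1 => // *; rewrite subrr normr0 ltW. Qed.

(** Linearity and the bound at level [k] are hypotheses because the three facts are intertwined:
    linearity at level [k.+1] needs the slice integral to be continuous, and its continuity needs
    linearity and the bound one level below. [rint_base] closes the induction. *)
Lemma rint_ccont_aux k K : 0 <= K ->
  (forall f g a, uccont k K f -> uccont k K g ->
     rint k (fun s => a * f s + g s) = a * rint k f + rint k g) ->
  (forall f M, uccont k K f -> (forall s, size s = k -> `|f s| <= M) ->
     `|rint k f| <= M * (2 * K) ^+ k) ->
  forall g, uccont k.+1 K g -> ccont K (fun t => rint k (fun s => g (t :: s))).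
Proof.
move=> K0 rl rb g gK; split=> [t|t Kt]; last first.
  transitivity (rint k (fun=> 0)).
    apply: rint_ext => s sk; case: gK => g0 _; apply: g0; rewrite /= ?sk//.
    by rewrite Kt.
  apply/eqP; rewrite -normr_le0 -[leRHS](mul0r ((2 * K) ^+ k)).
  by apply: rb => [|*]; [exact: uccont_cst0|rewrite normr0].
apply/cvgrPdist_le => e e0; have [_ gc] := gK.
(* The summand [1] keeps the divisor positive when [K = 0]. *)
have c0 : 0 < (2 * K) ^+ k + 1 by rewrite ltr_wpDl// exprn_ge0// mulr_ge0.
have [d d0 H] := gc _ (divr_gt0 e0 c0).
near=> u.
have -> : rint k (fun s => g (t :: s)) - rint k (fun s => g (u :: s)) =
    rint k (fun s => (- 1) * g (u :: s) + g (t :: s)).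
  rewrite rl; [|exact: uccont_slice..].
  by rewrite mulN1r addrC.
apply: le_trans (_ : e / ((2 * K) ^+ k + 1) * (2 * K) ^+ k <= _).
  apply: rb => [|s sk]; first by apply: uccont_lin; exact: uccont_slice.
  rewrite mulN1r addrC; apply: H; rewrite /= ?sk//.
  move=> [|i] /= _; last by rewrite subrr normr0.
  near: u; exact: (nbhsx_ballx t d d0).
by rewrite -mulrA ler_piMr ?(ltW e0)// mulrC ler_pdivrMr// mul1r lerDl.
Unshelve. all: by end_near. Qed.

Lemma rint_base k K : 0 <= K ->
  (forall f g a, uccont k K f -> uccont k K g ->
     rint k (fun s => a * f s + g s) = a * rint k f + rint k g) /\
  (forall f M, uccont k K f -> (forall s, size s = k -> `|f s| <= M) ->
     `|rint k f| <= M * (2 * K) ^+ k).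
Proof.
move=> K0; elim: k => [|k [IHl IHb]].
  by split=> //= f M _ fM; rewrite expr0 mulr1 fM.
have cc := rint_ccont_aux K0 IHl IHb; split=> [f g a fK gK|f M fK fM] /=.
  rewrite -(ccont_lin _ (cc _ fK) (cc _ gK)); apply: eq_Rintegral => t _.
  by rewrite IHl//; exact: uccont_slice.
rewrite exprSr mulrA; apply: ccont_bound => // [|t]; first exact: cc.
by apply: IHb => [|s sk]; [exact: uccont_slice|apply: fM; rewrite /= sk].
Qed.

Lemma rint_lin k K f g a : 0 <= K -> uccont k K f -> uccont k K g ->
  rint k (fun s => a * f s + g s) = a * rint k f + rint k g.
Proof. by move=> K0; have [+ _] := rint_base k K0; apply. Qed.

Lemma rint_bound k K f M : 0 <= K -> uccont k K f ->
  (forall s, size s = k -> `|f s| <= M) -> `|rint k f| <= M * (2 * K) ^+ k.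
Proof. by move=> K0; have [_] := rint_base k K0; apply. Qed.

Lemma rint_ccont k K g : 0 <= K -> uccont k.+1 K g ->
  ccont K (fun t => rint k (fun s => g (t :: s))).
Proof. by move=> K0; have [? ?] := rint_base k K0; exact: rint_ccont_aux. Qed.

Lemma iint_rint k K g : 0 <= K -> uccont k K g ->
  iint k (fun s => (g s)%:E) = (rint k g)%:E.
Proof.
move=> K0; elim: k g => [|k IH] g gK //=.
rewrite -(integral_ccont (rint_ccont K0 gK)); apply: eq_integral => t _.
by rewrite IH//; exact: uccont_slice.
Qed.

Lemma rint_le k K f g : 0 <= K -> uccont k K f -> uccont k K g ->
  (forall s, size s = k -> f s <= g s) -> rint k f <= rint k g.
Proof.
move=> K0; elim: k f g => [|k IH] f g fK gK fg /=; first exact: fg.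
apply: ccont_le (rint_ccont K0 fK) (rint_ccont K0 gK) _ => t.
by apply: IH => [||s sk]; [exact: uccont_slice..|apply: fg; rewrite /= sk].
Qed.

Lemma rint_shift k K f a : 0 <= K -> uccont k K f -> size a = k ->
  rint k (fun s => f (sadd a s)) = rint k f.
Proof.
move=> K0; elim: k f a => [|k IH] f [|a0 a] // fK [ak] /=.
rewrite -(Rintegral_shift a0 (rint_ccont K0 fK)); apply: eq_Rintegral => t _.
by rewrite -(IH (fun s => f (t + a0 :: s)) a)//; exact: uccont_slice.
Qed.

(** Serves, through [Int_lower], to show that the mollifier has positive mass. *)
Lemma rint_lower k K f e c : 0 <= K -> 0 <= e -> 0 <= c -> uccont k K f ->
  (forall s, size s = k -> 0 <= f s) ->
  (forall s, size s = k -> all (fun t => `|t| <= e) s -> c <= f s) ->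
  c * (2 * e) ^+ k <= rint k f.
Proof.
move=> K0 e0; elim: k f c => [|k IH] f c c0 fK f0 fc /=.
  by rewrite expr0 mulr1; exact: fc.
rewrite exprSr mulrA; apply: ccont_lower (rint_ccont K0 fK) _ _ => //.
- by rewrite mulr_ge0// exprn_ge0// mulr_ge0.
- move=> t; have := @rint_le k K (fun=> 0) (fun s => f (t :: s)) K0.
  have -> : rint k (fun=> 0) = 0.
    apply/eqP; rewrite -normr_le0 -[leRHS](mul0r ((2 * K) ^+ k)).
    by apply: rint_bound => // [|*]; [exact: uccont_cst0|rewrite normr0].
  apply; [exact: uccont_cst0|exact: uccont_slice|move=> s sk].
  by apply: f0; rewrite /= sk.
- move=> t te; apply: IH => //; first exact: uccont_slice.
    by move=> s sk; apply: f0; rewrite /= sk.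
  by move=> s sk se; apply: fc; rewrite /= ?sk// te.
Qed.

End SeqIntegral.

(** * The integral of continuous compactly supported functions on R^n *)

Section Unif.
Variable R : realType.

(** Only [x] has to lie in [A]: continuity is assumed in the whole space at the points of [A], so
    the second point may leave the compact set. *)
Lemma compact_unif_continuous (T : pseudoMetricType R) (A : set T) (f : T -> R) :
  compact A -> (forall x, A x -> {for x, continuous f}) ->
  forall e, 0 < e -> exists2 d, 0 < d &
    forall x y, A x -> ball x d y -> `|f x - f y| <= e.
Proof.
move=> /compact_near_coveringP cA cf e e0.
(* Compactness in near-covering form, along small positive [d]: half of the radius found at [x]
   bounds the displacement of the centre, the other half bounds [d]. *)
have /(_ _)[] := cA R 0^'+ (fun d x => forall y, ball x d y -> `|f x - f y| <= e) _.
  move=> x Ax.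
  have e2 : 0 < e / 2 by exact: divr_gt0.
  have /cvgrPdist_le/(_ _ e2)/nbhs_ballP[r /= r0 xr] := cf _ Ax.
  exists (ball x (r / 2), [set d | d < r / 2]).
    split; first by apply: nbhsx_ballx; exact: divr_gt0.
    by apply: nbhs_right_lt; exact: divr_gt0.
  move=> [x' d] /= [xx' dr] y x'y.
  have fx : `|f x - f x'| <= e / 2.
    by apply: xr; apply: le_ball xx'; rewrite ler_pdivrMr// ler_peMr ?(ltW r0)// ler1n.
  have fy : `|f x - f y| <= e / 2.
    apply: xr; rewrite (splitr r); apply: ball_triangle xx' _.
    by apply: le_ball x'y; exact: ltW.
  rewrite (splitr e) (_ : f x' - f y = (f x - f y) - (f x - f x')); last by ring.
  by rewrite (le_trans (ler_normB _ _))// lerD.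
move=> d /= d0 H; exists (d / 2); first exact: divr_gt0.
move=> x y Ax xy; apply: (H (d / 2) _ _ x Ax y xy) => //=; last exact: divr_gt0.
rewrite sub0r normrN gtr0_norm; last exact: divr_gt0.
by rewrite ltr_pdivrMr// ltr_pMr// ltr1n.
Qed.

End Unif.

Section Integral.
Variables (R : realType) (n : nat).
Notation V := 'rV[R]_n.
Implicit Types (f g : V -> R) (x y z : V) (K M : R) (i : 'I_n).

(** The support lies in a cube rather than in a Euclidean ball, so that every one-dimensional slice
    has its support in the same interval. *)
Definition cc K f :=
  continuous f /\ forall x i, K < `|x ord0 i| -> f x = 0.

Definition Cc f := exists2 K, 0 <= K & cc K f.

Definition row_of_seq (s : seq R) : V := \row_(i < n) s`_i.

Definition Int f : R := rint n (fun s => f (row_of_seq s)).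

Lemma cc_unif K f : 0 <= K -> cc K f -> forall e, 0 < e ->
  exists2 d, 0 < d & forall x y, (forall i, `|x ord0 i - y ord0 i| < d) ->
    `|f x - f y| <= e.
Proof.
move=> K0 [cf f0] e e0.
(* Half-side [K + 1]: if [x] lies outside this cube, any [y] whose coordinates are within [1] of
   those of [x] is outside the support as well. *)
have cA : compact [set v : V | forall i, v ord0 i \in `[(- (K + 1)), (K + 1)]].
  apply: (@rV_compact _ _ (fun=> `[(- (K + 1)), (K + 1)]%classic)).
  by move=> _; exact: segment_compact.
have [d d0 H] := compact_unif_continuous cA (fun x _ => cf x) e0.
exists (Num.min d 1) => [|x y xy]; first by rewrite lt_min d0 ltr01.
have [Ax|/existsNP[i /negP]] :=
    pselect (forall i, x ord0 i \in `[(- (K + 1)), (K + 1)]).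
  apply: H => //; split=> // j i; rewrite ord1.
  by have := xy i; rewrite lt_min => /andP[].
rewrite in_itv/= -ler_norml -ltNge => xi.
rewrite (f0 x i) ?(f0 y i) ?subrr ?normr0 ?ltW//; last first.
  by rewrite (le_lt_trans _ xi)// lerDl.
have := xy i; rewrite lt_min => /andP[_].
have := ler_normD (x ord0 i - y ord0 i) (y ord0 i); rewrite subrK; lra.
Qed.

Lemma cc_uccont K f : 0 <= K -> cc K f -> uccont n K (fun s => f (row_of_seq s)).
Proof.
move=> K0 fK; split=> [s sn /(has_nthP 0)[i]|e e0].
  rewrite sn => ilt Ks; apply: (fK.2 _ (Ordinal ilt)).
  by rewrite mxE.
have [d d0 H] := cc_unif K0 fK e0; exists d => // s s' sn s'n ss'.
by apply: H => i; rewrite !mxE; exact: ss'.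
Qed.

Lemma cc_mono K L f : K <= L -> cc K f -> cc L f.
Proof. by move=> KL [cf f0]; split=> // x i Lx; apply: f0 (le_lt_trans KL Lx). Qed.

Lemma Cc_uccont f : Cc f -> exists2 K, 0 <= K & uccont n K (fun s => f (row_of_seq s)).
Proof. by move=> [K K0 fK]; exists K => //; exact: cc_uccont. Qed.

Lemma Cc2_uccont f g : Cc f -> Cc g -> exists2 K, 0 <= K &
  uccont n K (fun s => f (row_of_seq s)) /\ uccont n K (fun s => g (row_of_seq s)).
Proof.
move=> [K K0 fK] [L L0 gL]; exists (K + L); first exact: addr_ge0.
split; apply: cc_uccont; rewrite ?addr_ge0//.
  by apply: cc_mono fK; rewrite lerDl.
by apply: cc_mono gL; rewrite lerDr.
Qed.

Lemma intRn_Cc f : Cc f -> intRn (fun x => (f x)%:E) = (Int f)%:E.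
Proof. by move=> /Cc_uccont[K K0 fK]; rewrite -(iint_rint K0 fK). Qed.

Lemma Int_lin a f g : Cc f -> Cc g -> Int (fun x => a * f x + g x) = a * Int f + Int g.
Proof.
by move=> cf cg; have [K K0 [? ?]] := Cc2_uccont cf cg; rewrite -(@rint_lin _ _ K).
Qed.

Lemma Int_le f g : Cc f -> Cc g -> (forall x, f x <= g x) -> Int f <= Int g.
Proof.
move=> cf cg fg; have [K K0 [? ?]] := Cc2_uccont cf cg.
by apply: (@rint_le _ _ K).
Qed.

Lemma Int_bound K f M : 0 <= K -> cc K f -> (forall x, `|f x| <= M) ->
  `|Int f| <= M * (2 * K) ^+ n.
Proof. by move=> K0 fK fM; apply: rint_bound => //; exact: cc_uccont. Qed.

Lemma Int_shift f y : Cc f -> Int (fun x => f (x + y)) = Int f.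
Proof.
move=> cf; have [K K0 fK] := Cc_uccont cf.
pose a := mkseq (fun k : nat => oapp (y ord0) 0 (insub k : option 'I_n)) n.
have sa : size a = n by rewrite size_mkseq.
rewrite /Int -(rint_shift K0 fK sa).
apply: rint_ext => s sn; congr f; apply/rowP => i; rewrite !mxE.
by rewrite (@nth_sadd _ n)// nth_mkseq// valK.
Qed.

Lemma Int_lower f e c : 0 <= e -> 0 <= c -> Cc f -> (forall x, 0 <= f x) ->
  (forall x, (forall i, `|x ord0 i| <= e) -> c <= f x) ->
  c * (2 * e) ^+ n <= Int f.
Proof.
move=> e0 c0 cf f0 fc; have [K K0 fK] := Cc_uccont cf.
apply: rint_lower K0 e0 c0 fK _ _ => [s sn|s sn /(all_nthP 0) se]; first exact: f0.
by apply: fc => i; rewrite mxE; apply: se; rewrite sn.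
Qed.

Lemma Cc_lin a f g : Cc f -> Cc g -> Cc (fun x => a * f x + g x).
Proof.
move=> [K K0 [fc f0]] [L L0 [gc g0]]; exists (K + L); first exact: addr_ge0.
split=> [x|x i xi].
  exact: (cvgD (cvgM (cvg_cst a) (fc x)) (gc x)).
rewrite (f0 x i) ?(g0 x i) ?mulr0 ?addr0//; apply: le_lt_trans xi.
  by rewrite lerDr.
by rewrite lerDl.
Qed.

Lemma Cc0 : Cc (fun=> 0).
Proof. by exists 0 => //; split=> [x|x i _] //; exact: cst_continuous. Qed.

Lemma Int0 : Int (fun=> 0) = 0.
Proof. by have := Int_lin (-1) Cc0 Cc0; rewrite mulr0 addr0 mulN1r addNr. Qed.

Lemma eqCc f g : f =1 g -> Cc f -> Cc g.
Proof. by move=> /funext ->. Qed.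

Lemma eqInt f g : f =1 g -> Int f = Int g.
Proof. by move=> /funext ->. Qed.

Lemma CcZ a f : Cc f -> Cc (fun x => a * f x).
Proof. by move=> cf; apply: eqCc (Cc_lin a cf Cc0) => x; rewrite addr0. Qed.

Lemma CcD f g : Cc f -> Cc g -> Cc (fun x => f x + g x).
Proof. by move=> cf cg; apply: eqCc (Cc_lin 1 cf cg) => x; rewrite mul1r. Qed.

Lemma CcB f g : Cc f -> Cc g -> Cc (fun x => f x - g x).
Proof.
by move=> cf cg; apply: eqCc (Cc_lin (-1) cg cf) => x; rewrite mulN1r addrC.
Qed.

Lemma Cc_sum (F : 'I_n -> V -> R) : (forall i, Cc (F i)) ->
  Cc (fun x => \sum_i F i x).
Proof.
move=> cF; elim: (index_enum _) => [|j r IH].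
  by apply: eqCc Cc0 => x; rewrite big_nil.
by apply: eqCc (CcD (cF j) IH) => x; rewrite big_cons.
Qed.

Lemma CcM f g : Cc f -> continuous g -> Cc (fun x => f x * g x).
Proof.
move=> [K K0 [fc f0]] gc; exists K => //; split=> [x|x i xi].
  exact: (cvgM (fc x) (gc x)).
by rewrite (f0 x i) ?mul0r.
Qed.

Lemma Cc_norm f : Cc f -> Cc (fun x => `|f x|).
Proof.
move=> [K K0 [fc f0]]; exists K => //; split=> [x|x i xi].
  exact: (cvg_norm (fc x)).
by rewrite (f0 x i) ?normr0.
Qed.

Lemma cc_shift K L f y : cc K f -> (forall i, `|y ord0 i| <= L) ->
  cc (K + L) (fun x => f (x + y)).
Proof.
move=> [fc f0] yL; split=> [x|x i xi].
  have xy : x' + y @[x' --> x] --> x + y by exact: (cvgD cvg_id (cvg_cst y)).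
  exact: (cvg_comp _ _ xy (fc (x + y))).
apply: (f0 _ i); rewrite mxE; have := yL i.
have := ler_normB (x ord0 i + y ord0 i) (y ord0 i); rewrite addrK; lra.
Qed.

Lemma Cc_shift f y : Cc f -> Cc (fun x => f (x + y)).
Proof.
move=> [K K0 fK]; exists (K + \sum_i `|y ord0 i|); first by rewrite addr_ge0// sumr_ge0.
apply: cc_shift fK _ => i; rewrite (bigD1 i)//= lerDl; exact: sumr_ge0.
Qed.

Lemma IntZ a f : Cc f -> Int (fun x => a * f x) = a * Int f.
Proof.
move=> cf; rewrite -[RHS]addr0 -Int0 -Int_lin ?Int0//; last exact: Cc0.
by apply: eqInt => x; rewrite addr0.
Qed.

Lemma IntD f g : Cc f -> Cc g -> Int (fun x => f x + g x) = Int f + Int g.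
Proof.
move=> cf cg; rewrite -[Int f]mul1r -Int_lin//.
by apply: eqInt => x; rewrite mul1r.
Qed.

Lemma IntB f g : Cc f -> Cc g -> Int (fun x => f x - g x) = Int f - Int g.
Proof.
move=> cf cg; rewrite addrC -mulN1r -Int_lin//.
by apply: eqInt => x; rewrite mulN1r addrC.
Qed.

Lemma Int_sum (F : 'I_n -> V -> R) : (forall i, Cc (F i)) ->
  Int (fun x => \sum_i F i x) = \sum_i Int (F i).
Proof.
move=> cF; suff H r : Cc (fun x => \sum_(i <- r) F i x) /\
    Int (fun x => \sum_(i <- r) F i x) = \sum_(i <- r) Int (F i).
  by have [] := H (index_enum _).
elim: r => [|j r [IHc IHe]].
  split; first by apply: eqCc Cc0 => x; rewrite big_nil.
  by rewrite big_nil -[RHS]Int0; apply: eqInt => x; rewrite big_nil.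
split; first by apply: eqCc (CcD (cF j) IHc) => x; rewrite big_cons.
rewrite big_cons -IHe -(IntD (cF j) IHc).
by apply: eqInt => x; rewrite big_cons.
Qed.

End Integral.

(** * Directional derivatives, integration by parts, convolution *)

Section Deriv.
Variables (R : realType) (V : normedModType R).
Implicit Types (f : V -> R) (x v : V).

(** Transfers the one-variable chain rule and mean value theorem to directional derivatives. *)
Lemma is_derive_line f x v (t l : R) :
  is_derive t (1 : R) (fun s : R => f (x + s *: v)) l <-> is_derive (x + t *: v) v f l.
Proof.
have E : (fun h : R => h^-1 *: (((fun s => f (x + s *: v)) \o shift t) (h *: 1) -
      f (x + t *: v))) =
    (fun h => h^-1 *: ((f \o shift (x + t *: v)) (h *: v) - f (x + t *: v))).
  apply/funext => h /=; congr (_ *: (f _ - _)).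
  by rewrite scaler1 scalerDl addrCA.
by split=> -[H1 H2]; split; move: H1 H2; rewrite /derivable /derive E.
Qed.

Lemma is_derive_comp f (F : R -> R) x v (l l' : R) :
  is_derive x v f l -> is_derive (f x) (1 : R) F l' ->
  is_derive x v (fun y => F (f y)) (l' * l).
Proof.
move=> df dF; have x0 : x = x + (0 : R) *: v by rewrite scale0r addr0.
rewrite x0; apply/is_derive_line.
by apply: is_derive1_comp; [rewrite -x0|apply/is_derive_line; rewrite -x0].
Qed.

Lemma is_deriveP f x v (l : R) : is_derive x v f l <->
  forall e, 0 < e -> exists2 r, 0 < r & forall h, h != 0 -> `|h| < r ->
    `|(f (x + h *: v) - f x) / h - l| <= e.
Proof.
have E h : h^-1 *: ((f \o shift x) (h *: v) - f x) = (f (x + h *: v) - f x) / h.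
  by rewrite /= [LHS]mulrC (addrC x).
split=> [[df dl] e e0|H].
  have : (fun h => h^-1 *: ((f \o shift x) (h *: v) - f x)) @ 0^' --> l.
    by rewrite -dl; exact: df.
  move/cvgrPdist_le => /(_ _ e0)/nbhs_ballP[r /= r0 rH].
  exists r => // h h0 hr; rewrite distrC -E; apply: rH => //.
  by rewrite -ball_normE /ball_/= sub0r normrN.
have c : (fun h => h^-1 *: ((f \o shift x) (h *: v) - f x)) @ 0^' --> l.
  apply/cvgrPdist_le => e e0; have [r r0 rH] := H e e0.
  exists r => //= h; rewrite /= sub0r normrN => hr h0.
  by rewrite distrC E; exact: rH.
split; first by apply/cvg_ex; exists l.
exact: (cvg_lim _ c).
Qed.

Lemma line_mvt f x v (h : R) : (forall y, derivable f y v) ->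
  exists2 c : R, `|c| <= `|h| & f (x + h *: v) - f x = h * 'D_v f (x + c *: v).
Proof.
move=> df; pose g (s : R) := f (x + s *: v).
have dg (s : R) : is_derive s (1 : R) g ('D_v f (x + s *: v)).
  by apply/is_derive_line; exact: derivableP.
have cg A : {within A, continuous g}.
  by apply: continuous_subspaceT => s; apply/differentiable_continuous/derivable1_diffP.
have g0 : g 0 = f x by rewrite /g scale0r addr0.
have [h0|h0] := leP 0 h.
  have [c] := MVT_segment h0 (fun s _ => dg s) (cg _).
  rewrite in_itv/= g0 subr0 => /andP[c0 ch] E; exists c; last by rewrite mulrC -E.
  by rewrite !ger0_norm.
have [c] := MVT_segment (ltW h0) (fun s _ => dg s) (cg _).
rewrite in_itv/= g0 sub0r => /andP[hc c0] E; exists c; last first.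
  by rewrite -[LHS]opprK opprB E mulrN opprK mulrC.
by rewrite !ler0_norm ?lerN2// ltW.
Qed.

End Deriv.

(** * Difference quotients, vanishing integrals of derivatives, and convolution in R^n *)

Section Cc1.
Variables (R : realType) (n : nat).
Notation V := 'rV[R]_n.
Implicit Types (f g rho : V -> R) (x y z : V) (K M : R) (i : 'I_n).

Notation dir i := (delta_mx ord0 i : 'rV[R]_n).

Lemma dirE i j : (dir i) ord0 j = (j == i)%:R.
Proof. by rewrite mxE eqxx. Qed.

Lemma norm_dir (h : R) i j : `|(h *: dir i) ord0 j| <= `|h|.
Proof.
rewrite mxE dirE normrM; case: (j == i); first by rewrite normr1 mulr1.
by rewrite normr0 mulr0.
Qed.

(** By the mean value theorem the quotient is the partial derivative at a point at distance at most
    [|h|], and that derivative is uniformly continuous. *)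
Lemma diffquot_unif K g i : 0 <= K -> (forall x, derivable g x (dir i)) ->
  cc K (partial i g) -> forall e, 0 < e -> exists2 r, 0 < r &
  forall h, h != 0 -> `|h| < r -> forall x,
    `|(g (x + h *: dir i) - g x) / h - partial i g x| <= e.
Proof.
move=> K0 dg cg e e0; have [r r0 H] := cc_unif K0 cg e0; exists r => // h h0 hr x.
have [c ch ->] := line_mvt x h dg.
rewrite mulrAC divff// mul1r; apply: H => j.
by rewrite mxE addrC addrK; apply: le_lt_trans hr; apply: le_trans ch; exact: norm_dir.
Qed.

Lemma eq0_small (a C : R) : (forall e, 0 < e -> `|a| <= e * C) -> a = 0.
Proof.
move=> H; apply/eqP; rewrite -normr_le0; apply/ler_addgt0Pl => e e0; rewrite addr0.
have C0 : 0 < `|C| + 1 by rewrite ltr_wpDl.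
apply: le_trans (H (e / (`|C| + 1)) _) _; first exact: divr_gt0.
rewrite -mulrA ler_piMr ?(ltW e0)// mulrC ler_pdivrMr// mul1r.
by rewrite (le_trans (ler_norm C))// lerDl.
Qed.

Lemma diffquot_cc K g i h : 0 <= K -> `|h| <= 1 -> cc K g -> cc K (partial i g) ->
  cc (K + 1) (fun x => (g (x + h *: dir i) - g x) / h - partial i g x).
Proof.
move=> K0 h1 gK dgK.
have g1 : cc (K + 1) (fun x => g (x + h *: dir i)).
  by apply: cc_shift gK _ => j; exact: le_trans (norm_dir _ _ _) h1.
have KK : K <= K + 1 by rewrite lerDl.
have g2 := cc_mono KK gK; have g3 := cc_mono KK dgK.
split=> [x|x j xj].
  exact: (cvgB (cvgM (cvgB (g1.1 x) (g2.1 x)) (cvg_cst h^-1)) (g3.1 x)).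
by rewrite (g1.2 x j)// (g2.2 x j)// (g3.2 x j)// subrr mul0r subrr.
Qed.

(** By translation invariance every difference quotient has integral zero, and the quotients
    converge uniformly to the derivative with supports in one cube. *)
Lemma Int_partial K g i : 0 <= K -> cc K g -> (forall x, derivable g x (dir i)) ->
  cc K (partial i g) -> Int (partial i g) = 0.
Proof.
move=> K0 gK dg dgK; apply: (@eq0_small _ ((2 * (K + 1)) ^+ n)) => e e0.
have [r r0 H] := diffquot_unif K0 dg dgK e0.
pose h := Num.min (r / 2) 1.
have h0 : 0 < h by rewrite lt_min ltr01 divr_gt0.
have hr : `|h| < r.
  by rewrite gtr0_norm// gt_min ltr_pdivrMr// ltr_pMr// ltr1n.
have h1 : `|h| <= 1 by rewrite gtr0_norm// ge_min lexx orbT.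
have cg : Cc g by exists K.
have cdg : Cc (partial i g) by exists K.
have cgs := Cc_shift (h *: dir i) cg.
have cq := CcZ h^-1 (CcB cgs cg).
have E : Int (fun x => (g (x + h *: dir i) - g x) / h - partial i g x) = - Int (partial i g).
  rewrite (eqInt (g := fun x => h^-1 * (g (x + h *: dir i) - g x) - partial i g x)).
    rewrite (IntB cq cdg) (IntZ _ (CcB cgs cg)) (IntB cgs cg) Int_shift//.
    by rewrite subrr mulr0 sub0r.
  by move=> x; rewrite mulrC.
rewrite -normrN -E; apply: Int_bound; first exact: addr_ge0.
  exact: diffquot_cc.
by apply: H => //; rewrite gt_eqF.
Qed.

(** The kernel is evaluated at [x - z], so that as a function of [x] it is directly a test function
    centred at [z]. Each derivative in [z] therefore brings a minus sign. *)
Definition conv f rho z := Int (fun x => f x * rho (x - z)).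

Lemma convE f rho z : continuous f -> Cc rho ->
  conv f rho z = Int (fun x => rho x * f (x + z)).
Proof.
move=> fc rc; rewrite /conv -(Int_shift (f := fun x => f x * rho (x - z)) z).
  by apply: eqInt => x; rewrite addrK mulrC.
by apply: eqCc (CcM (Cc_shift (- z) rc) fc) => x; rewrite mulrC.
Qed.

Lemma continuous_shiftr f z : continuous f -> continuous (fun x => f (x + z)).
Proof.
move=> fc x; have xz : x' + z @[x' --> x] --> x + z by exact: (cvgD cvg_id (cvg_cst z)).
exact: (cvg_comp _ _ xz (fc (x + z))).
Qed.

Lemma conv_Cc f rho z : continuous f -> Cc rho -> Cc (fun x => f x * rho (x - z)).
Proof.
by move=> fc rc; apply: eqCc (CcM (Cc_shift (- z) rc) fc) => x; rewrite mulrC.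
Qed.

Lemma bound_conv K f M rho z (e : R) : 0 <= K -> continuous f -> (forall x, `|f x| <= M) ->
  cc K rho -> (forall x, `|rho x| <= e) -> `|conv f rho z| <= e * M * (2 * K) ^+ n.
Proof.
move=> K0 fc fM rK re; have rc : Cc rho by exists K.
rewrite convE//; apply: Int_bound => //.
  split=> [x|x i xi]; last by rewrite (rK.2 x i)// mul0r.
  exact: (cvgM (rK.1 x) (@continuous_shiftr f z fc x)).
by move=> x; rewrite normrM ler_pM.
Qed.

(** Here [f] is only bounded and continuous, so the modulus of continuity is taken from the kernel:
    the difference of two values is one convolution, with a difference of two translated kernels. *)
Lemma continuous_conv K f M rho : 0 <= K -> continuous f -> (forall x, `|f x| <= M) ->
  cc K rho -> continuous (conv f rho).
Proof.
move=> K0 fc fM rK; have rc : Cc rho by exists K.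
suff cz z : conv f rho y @[y --> z] --> conv f rho z by exact: cz.
have M0 : 0 <= M := le_trans (normr_ge0 _) (fM 0).
apply/(@cvgrPdist_le _ _ _ _ (nbhs_filter z)) => e e0.
pose C := M * (2 * (K + 1)) ^+ n + 1.
have C0 : 0 < C by rewrite ltr_wpDl// mulr_ge0// exprn_ge0// mulr_ge0// addr_ge0.
have [d d0 H] := cc_unif K0 rK (divr_gt0 e0 C0).
apply/nbhs_ballP; exists (Num.min d 1) => [|y zy] /=; first by rewrite lt_min d0 ltr01.
have yz i : `|(z - y) ord0 i| < d /\ `|(z - y) ord0 i| <= 1.
  by move: zy => [_] /(_ ord0 i); rewrite /ball/= !mxE lt_min => /andP[-> /ltW].
pose s := fun x => rho x - rho (x + (z - y)).
have sK : cc (K + 1) s.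
  have s1 : cc (K + 1) (fun x => rho (x + (z - y))).
    by apply: cc_shift rK _ => i; have [] := yz i.
  have s2 : cc (K + 1) rho by apply: cc_mono rK; rewrite lerDl.
  split=> [x|x i xi]; first exact: (cvgB (s2.1 x) (s1.1 x)).
  by rewrite /s (s2.2 x i)// (s1.2 x i)// subrr.
have -> : conv f rho z - conv f rho y = conv f s z.
  rewrite /conv -IntB; [|exact: conv_Cc..].
  by apply: eqInt => x; rewrite /s -mulrBr subrKA.
have /le_trans -> // : `|conv f s z| <= e / C * M * (2 * (K + 1)) ^+ n.
  apply: bound_conv => //; first exact: addr_ge0.
  move=> x; apply: H => i; have [+ _] := yz i.
  by rewrite [(x + _) _ _]mxE opprD addNKr normrN.
rewrite -!mulrA ler_piMr ?(ltW e0)// mulrC ler_pdivrMr// mul1r.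
by rewrite /C lerDl.
Qed.

(** Moving [z] by [h] moves the kernel by [- h]. The quotient of the convolution is thus minus the
    convolution with the kernel's quotient of step [- h], which converges uniformly by
    [diffquot_unif]. *)
Lemma is_derive_conv K f M rho i z : 0 <= K -> continuous f -> (forall x, `|f x| <= M) ->
  cc K rho -> (forall x, derivable rho x (dir i)) -> cc K (partial i rho) ->
  is_derive z (dir i) (conv f rho) (- conv f (partial i rho) z).
Proof.
move=> K0 fc fM rK dr drK; have rc : Cc rho by exists K.
have drc : Cc (partial i rho) by exists K.
have M0 : 0 <= M := le_trans (normr_ge0 _) (fM 0).
apply/is_deriveP => e e0.
pose C := M * (2 * (K + 1)) ^+ n + 1.
have C0 : 0 < C by rewrite ltr_wpDl// mulr_ge0// exprn_ge0// mulr_ge0// addr_ge0.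
have [r r0 H] := diffquot_unif K0 dr drK (divr_gt0 e0 C0).
exists (Num.min r 1) => [|h h0]; first by rewrite lt_min r0 ltr01.
rewrite lt_min => /andP[hr /ltW h1].
have hN0 : - h != 0 by rewrite oppr_eq0.
rewrite -normrN in hr; rewrite -normrN in h1.
pose s x := (rho (x + (- h) *: dir i) - rho x) / (- h) - partial i rho x.
have sK : cc (K + 1) s := diffquot_cc K0 h1 rK drK.
have -> : (conv f rho (z + h *: dir i) - conv f rho z) / h - - conv f (partial i rho) z =
    - conv f s z.
  rewrite /conv; have cz : Cc (fun x => f x * rho (x - z)) by exact: conv_Cc.
  have czh : Cc (fun x => f x * rho (x - (z + h *: dir i))) by exact: conv_Cc.
  have cd : Cc (fun x => f x * partial i rho (x - z)) by exact: conv_Cc.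
  have cB := CcB czh cz.
  rewrite (eqInt (f := fun x => f x * s (x - z)) (g := fun x =>
    (- h^-1) * (f x * rho (x - (z + h *: dir i)) - f x * rho (x - z)) -
     f x * partial i rho (x - z))).
    rewrite (IntB (CcZ _ cB) cd) (IntZ _ cB) (IntB czh cz).
    by ring.
  move=> x; rewrite /s scaleNr -addrA -opprD invrN; ring.
rewrite normrN; have /le_trans -> // : `|conv f s z| <= e / C * M * (2 * (K + 1)) ^+ n.
  apply: bound_conv => //; first exact: addr_ge0.
  by apply: H.
rewrite -!mulrA ler_piMr ?(ltW e0)// mulrC ler_pdivrMr// mul1r.
by rewrite /C lerDl.
Qed.

End Cc1.

(** * Smooth functions and a bump function *)

Section Bump.
Variable R : realType.
Implicit Types (t : R) (k : nat).

Lemma is_derive_near (V : normedModType R) (f g : V -> R) (x v : V) (l r : R) :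
  0 < r -> (forall h : R, `|h| < r -> f (x + h *: v) = g (x + h *: v)) ->
  is_derive x v g l -> is_derive x v f l.
Proof.
move=> r0 fg /is_deriveP dg; apply/is_deriveP => e e0.
have [s s0 H] := dg e e0; exists (Num.min r s) => [|h h0].
  by rewrite lt_min r0.
rewrite lt_min => /andP[hr hs]; rewrite fg//.
have := fg 0; rewrite normr0 scale0r addr0 => -> //.
exact: H.
Qed.

Lemma is_derive_exp (V : normedModType R) (f : V -> R) (x v : V) k (l : R) :
  is_derive x v f l -> is_derive x v (fun y => f y ^+ k) (k%:R * f x ^+ k.-1 * l).
Proof.
move=> df; rewrite (_ : (fun _ => _) = f ^+ k); first exact: is_deriveX.
by apply/funext => y; rewrite exprfctE.
Qed.

Lemma is_derive_addf (V : normedModType R) (f g : V -> R) (x v : V) (l l' : R) :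
  is_derive x v f l -> is_derive x v g l' -> is_derive x v (fun y => f y + g y) (l + l').
Proof. exact: is_deriveD. Qed.

Lemma is_derive_mulf (V : normedModType R) (f g : V -> R) (x v : V) (l l' : R) :
  is_derive x v f l -> is_derive x v g l' ->
  is_derive x v (fun y => f y * g y) (f x * l' + g x * l).
Proof. exact: is_deriveM. Qed.

Lemma is_derive_cstf (V : normedModType R) (x v : V) (c : R) : is_derive x v (fun=> c) 0.
Proof. exact: is_derive_cst. Qed.

(** The powers [t ^- k] are carried along because the linear span of this family is closed under
    differentiation; [k = 0] is the classical flat function [exp(-1/t)]. *)
Definition beta k t : R := if 0 < t then t ^- k * expR (- t^-1) else 0.

Lemma beta_ge0 k t : 0 <= beta k t.
Proof.
rewrite /beta; case: ifPn => // t0.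
by rewrite mulr_ge0 ?expR_ge0// invr_ge0 exprn_ge0// ltW.
Qed.

Lemma beta_le0 k t : t <= 0 -> beta k t = 0.
Proof. by rewrite /beta ltNge => ->. Qed.

Lemma beta0_gt0 t : 0 < t -> 0 < beta 0 t.
Proof. by rewrite /beta => ->; rewrite expr0 invr1 mul1r expR_gt0. Qed.

(** With [y = 1 / ((k+2) t)], the inequality [exp y >= y] raised to the power [k+2] gives
    [exp(1/t) >= y^(k+2)]. The quadratic bound is what makes the derivative of [beta k] vanish at
    [0]. *)
Lemma beta_le k t : beta k t <= k.+2%:R ^+ k.+2 * t ^+ 2.
Proof.
rewrite /beta; case: ifPn => [t0|_]; last by rewrite mulr_ge0 ?sqr_ge0 ?exprn_ge0.
have N0 : (0 : R) < k.+2%:R by [].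
have E : (k.+2%:R * t)^-1 ^+ k.+2 <= expR t^-1.
  rewrite (_ : t^-1 = k.+2%:R * (k.+2%:R * t)^-1).
    rewrite expRM_natl lerXn2r ?nnegrE ?expR_ge0//.
      by rewrite invr_ge0 mulr_ge0// ltW.
    by apply: le_trans (expR_ge1Dx _); rewrite lerDr.
  by rewrite invfM mulrA divff ?mul1r// gt_eqF.
rewrite expRN ler_pdivrMr ?expR_gt0//.
rewrite -[leLHS]mulr1 ler_pdivrMl ?exprn_gt0//.
have -> : t ^+ k * (k.+2%:R ^+ k.+2 * t ^+ 2 * expR t^-1) = (k.+2%:R * t) ^+ k.+2 * expR t^-1.
  rewrite exprMn; move: (k.+2%:R ^+ k.+2) => a.
  by rewrite -(addn2 k) exprD; ring.
by move: E; rewrite exprVn -[X in X <= _]mulr1 ler_pdivrMl ?exprn_gt0 ?mulr_gt0//.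
Qed.

Lemma is_derive_beta k t :
  is_derive t (1 : R) (beta k) (beta k.+2 t - k%:R * beta k.+1 t).
Proof.
have [t0|t0|t0] := ltgtP 0 t; last first.
- rewrite -t0 !beta_le0// mulr0 subr0; apply/is_deriveP => e e0.
  pose C : R := k.+2%:R ^+ k.+2; have C0 : 0 < C by rewrite exprn_gt0.
  exists (e / C) => [|h h0 he]; first exact: divr_gt0.
  rewrite add0r scaler1 (beta_le0 _ (lexx 0)) !subr0 normrM normfV.
  rewrite ler_pdivrMr ?normr_gt0// ger0_norm ?beta_ge0//.
  apply: le_trans (beta_le _ _) _; rewrite -/C -(real_normK (num_real h)) expr2 mulrA.
  rewrite ler_wpM2r//; move: he; rewrite ltr_pdivlMr// => /ltW.
  by rewrite mulrC.
- rewrite !beta_le0 ?(ltW t0)// mulr0 subr0.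
  apply: (@is_derive_near _ _ (cst 0) _ _ _ (- t)); rewrite ?oppr_gt0//.
  move=> h ht; rewrite beta_le0// scaler1; have := ler_norm h; lra.
- apply: (@is_derive_near _ _ (fun s : R => s^-1 ^+ k * expR (- s^-1)) _ _ _ t) => //.
    move=> h ht; rewrite /beta ifT ?exprVn// scaler1.
    by move: ht; rewrite ltr_norml => /andP[]; lra.
  have tn0 : t != 0 by rewrite gt_eqF.
  have dV : is_derive t (1 : R) (fun s : R => s^-1) (- t ^- 2).
    have := is_deriveV (f := id) tn0 (is_derive_id t (1 : R)).
    by move=> /is_derive_eq; apply; rewrite scaler1.
  have dX : is_derive t (1 : R) (fun s : R => s^-1 ^+ k) (k%:R * t^-1 ^+ k.-1 * - t ^- 2).
    exact: is_derive_exp.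
  have dE : is_derive t (1 : R) (fun s : R => expR (- s^-1)) (expR (- t^-1) * (t ^- 2)).
    have dN : is_derive t (1 : R) (fun s : R => - s^-1) (t ^- 2).
      by apply: is_derive_eq (is_deriveN dV) _; rewrite opprK.
    exact: is_derive1_comp (is_derive_expR _) dN.
  apply: is_derive_eq (is_deriveM dX dE) _.
  rewrite /beta t0 /GRing.scale/= -!exprVn.
  case: k {dX} => [|k]; first by rewrite expr0 !mul0r; ring.
  by rewrite /= !exprS; ring.
Qed.

End Bump.

(** * Smoothness of the radial bump *)

Section Smooth.
Variables (R : realType) (n : nat).
Notation V := 'rV[R]_n.
Implicit Types (f g : V -> R) (x y z : V) (i j : 'I_n).
Notation dir i := (delta_mx ord0 i : 'rV[R]_n).

(** A coinduction principle: iterated derivatives need no explicit formula once a class of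
    continuous functions closed under partial derivatives is exhibited. *)
Lemma smooth_coind (S : (V -> R) -> Prop) :
  (forall f, S f -> continuous f) ->
  (forall f i, S f -> exists2 g, S g & forall x, is_derive x (dir i) f (g x)) ->
  forall f, S f -> smooth f.
Proof.
move=> Sc Sd f Sf.
have Sit s : S (iter_partial s f).
  elim: s => [|i s IH] //=; have [g Sg dg] := Sd _ i IH.
  suff -> : partial i (iter_partial s f) = g by [].
  by apply/funext => x; rewrite /partial; have [_ ->] := dg x.
split=> [s i x|s]; last exact: Sc.
by have [g _ dg] := Sd _ i (Sit s); have [] := dg x.
Qed.

Definition sqn x : R := \sum_(j < n) x ord0 j ^+ 2.

Lemma is_derive_coord j i x :
  is_derive x (dir i) (fun x : V => x ord0 j) ((j == i)%:R : R).
Proof.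
apply/is_deriveP => e e0; exists 1 => // h h0 _.
by rewrite 2!mxE dirE addrAC subrr add0r mulrAC divff// mul1r subrr normr0 ltW.
Qed.

Lemma is_derive_sqn i x : is_derive x (dir i) sqn (2 * x ord0 i).
Proof.
have -> : sqn = \sum_(j < n) (fun x : V => x ord0 j ^+ 2).
  by apply/funext => y; rewrite fct_sumE.
have H j : is_derive x (dir i) (fun y : V => y ord0 j ^+ 2)
    (2 * x ord0 j * (j == i)%:R).
  exact: is_derive_eq (is_derive_exp 2 (is_derive_coord j i x)) _.
apply: is_derive_eq (is_derive_sum H) _.
rewrite (bigD1 i)//= eqxx mulr1 big1 ?addr0// => j /negbTE ->.
by rewrite mulr0.
Qed.

Lemma continuous_coord j : continuous (fun x : V => x ord0 j).
Proof. exact: coord_continuous. Qed.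

Lemma continuous_compf (F : R -> R) f : continuous F -> continuous f ->
  continuous (fun x => F (f x)).
Proof. by move=> cF cf x; exact: (cvg_comp _ _ (cf x) (cF (f x))). Qed.

Lemma continuous_subf f g : continuous f -> continuous g ->
  continuous (fun x => f x - g x).
Proof. by move=> cf cg x; exact: (cvgB (cf x) (cg x)). Qed.

Lemma continuous_addf f g : continuous f -> continuous g ->
  continuous (fun x => f x + g x).
Proof. by move=> cf cg x; exact: (cvgD (cf x) (cg x)). Qed.

Lemma continuous_mulf f g : continuous f -> continuous g ->
  continuous (fun x => f x * g x).
Proof. by move=> cf cg x; exact: (cvgM (cf x) (cg x)). Qed.

Lemma continuous_sumf (F : 'I_n -> V -> R) : (forall j, continuous (F j)) ->
  continuous (fun x => \sum_j F j x).
Proof.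
move=> cF; elim: (index_enum _) => [|j r IH].
  rewrite (_ : (fun _ => _) = (fun=> 0)); first exact: cst_continuous.
  by apply/funext => x; rewrite big_nil.
rewrite (_ : (fun _ => _) = (fun x => F j x + \sum_(k <- r) F k x)).
  by move=> x; exact: (cvgD (cF j x) (IH x)).
by apply/funext => x; rewrite big_cons.
Qed.

Lemma continuous_sqn : continuous sqn.
Proof.
apply: continuous_sumf => j; apply: (@continuous_compf (fun t => t ^+ 2)).
  exact: exprn_continuous.
exact: continuous_coord.
Qed.

Lemma iter_partial_cat s t f :
  iter_partial (s ++ t) f = iter_partial s (iter_partial t f).
Proof. by elim: s => //= i s ->. Qed.

Lemma smooth_partial i f : smooth f -> smooth (partial i f).
Proof.
move=> [df cf]; split=> [s j x|s].
  by have := df (s ++ [:: i]) j x; rewrite iter_partial_cat.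
by have := cf (s ++ [:: i]); rewrite iter_partial_cat.
Qed.

Lemma smooth_continuous f : smooth f -> continuous f.
Proof. by move=> [_ /(_ [::])]. Qed.

Lemma smooth_derivable f i x : smooth f -> derivable f x (dir i).
Proof. by move=> [/(_ [::] i x)]. Qed.

(** The algebra generated by the bumps, the coordinates and the constants is closed under partial
    derivatives, the coordinates arising from the derivative of [sqn]. The parameter [r] is the
    square of the radius of the support. *)
Inductive bump_class (r : R) : (V -> R) -> Prop :=
| bump_beta k : bump_class r (fun x => beta k (r - sqn x))
| bump_coord j : bump_class r (fun x => x ord0 j)
| bump_cst c : bump_class r (fun=> c)
| bump_add f g : bump_class r f -> bump_class r g -> bump_class r (fun x => f x + g x)
| bump_mul f g : bump_class r f -> bump_class r g -> bump_class r (fun x => f x * g x).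

Lemma continuous_derive (F F' : R -> R) : (forall t, is_derive t (1 : R) F (F' t)) ->
  continuous F.
Proof.
by move=> dF t; apply/differentiable_continuous/derivable1_diffP; have [] := dF t.
Qed.

Lemma bump_class_smooth r f : bump_class r f -> smooth f.
Proof.
apply: smooth_coind => {}f.
- elim=> {f} [k|j|c|f g _ IHf _ IHg|f g _ IHf _ IHg].
  + apply: (@continuous_compf (beta k) (fun x => r - sqn x)).
      exact: continuous_derive (is_derive_beta k).
    by apply: (@continuous_subf (fun=> r)); [exact: cst_continuous|exact: continuous_sqn].
  + exact: continuous_coord.
  + exact: cst_continuous.
  + by move=> x; exact: (cvgD (IHf x) (IHg x)).
  + by move=> x; exact: (cvgM (IHf x) (IHg x)).
- move=> i; elim=> {f} [k|j|c|f g cf [f' cf' df] cg [g' cg' dg]|f g cf [f' cf' df] cg [g' cg' dg]].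
  + exists (fun x => (beta k.+2 (r - sqn x) + (- k%:R) * beta k.+1 (r - sqn x)) *
        ((-2) * x ord0 i)).
      apply: bump_mul; apply: bump_mul || apply: bump_add.
      * exact: bump_beta.
      * by apply: bump_mul; [exact: bump_cst|exact: bump_beta].
      * exact: bump_cst.
      * exact: bump_coord.
    move=> x; rewrite mulNr; apply: (@is_derive_comp _ _ (fun x => r - sqn x) (beta k)).
      apply: is_derive_eq (is_deriveB (is_derive_cstf x _ r) (is_derive_sqn i x)) _.
      by rewrite sub0r mulNr.
    exact: is_derive_beta.
  + by exists (fun=> (j == i)%:R) => [|x]; [exact: bump_cst|exact: is_derive_coord].
  + by exists (fun=> 0) => [|x]; [exact: bump_cst|exact: is_derive_cstf].
  + exists (fun x => f' x + g' x) => [|x]; first exact: bump_add.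
    exact: is_derive_addf.
  + exists (fun x => f x * g' x + g x * f' x) => [|x].
      by apply: bump_add; apply: bump_mul.
    exact: is_derive_mulf.
Qed.

Lemma is_derive_shiftf f x y v (l : R) :
  is_derive x v (fun z => f (z + y)) l <-> is_derive (x + y) v f l.
Proof.
split=> /is_deriveP H; apply/is_deriveP => e /H[r r0 {}H]; exists r => // h h0 hr.
  by have := H h h0 hr; rewrite addrAC.
by rewrite addrAC; exact: H.
Qed.

Lemma partial_shiftf i f y : (forall x, derivable f x (dir i)) ->
  partial i (fun z => f (z + y)) = fun z => partial i f (z + y).
Proof.
move=> df; apply/funext => x; rewrite /partial.
by have [_ ->] := (is_derive_shiftf f x y _ _).2 (derivableP (df (x + y))).
Qed.

Lemma smooth_shiftf f y : smooth f -> smooth (fun z => f (z + y)).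
Proof.
move=> sf; pose S g := exists2 h, smooth h & g = fun z => h (z + y).
apply: (@smooth_coind S); last by exists f.
  by move=> _ [h sh ->]; apply: (@continuous_shiftr _ _ h y); exact: smooth_continuous.
move=> _ i [h sh ->]; exists (fun z => partial i h (z + y)).
  by exists (partial i h) => //; exact: smooth_partial.
move=> x; apply/is_derive_shiftf; exact: is_derive_eq (derivableP (@smooth_derivable h i (x + y) sh)) _.
Qed.

End Smooth.

(** * Euclidean norm and semiconcavity of the distance *)

Section Euclid.
Variables (R : realType) (n : nat).
Notation V := 'rV[R]_n.
Implicit Types (x y z v : V) (i j : 'I_n).
Notation dir i := (delta_mx ord0 i : 'rV[R]_n).

Definition dot x y : R := \sum_(j < n) x ord0 j * y ord0 j.

Lemma sqn_ge0 x : 0 <= sqn x.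
Proof. by apply: sumr_ge0 => j _; exact: sqr_ge0. Qed.

Lemma enorm_ge0 x : 0 <= enorm x.
Proof. exact: sqrtr_ge0. Qed.

Lemma sqr_enorm x : enorm x ^+ 2 = sqn x.
Proof. by rewrite sqr_sqrtr// sqn_ge0. Qed.

Lemma sqnD x y : sqn (x + y) = sqn x + 2 * dot x y + sqn y.
Proof.
rewrite /sqn /dot mulr_sumr -!big_split/=; apply: eq_bigr => j _.
by rewrite mxE; ring.
Qed.

Lemma sqnZ a x : sqn (a *: x) = a ^+ 2 * sqn x.
Proof. by rewrite /sqn mulr_sumr; apply: eq_bigr => j _; rewrite mxE exprMn. Qed.

Lemma dotZl a x y : dot (a *: x) y = a * dot x y.
Proof. by rewrite /dot mulr_sumr; apply: eq_bigr => j _; rewrite mxE mulrA. Qed.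

Lemma dotZr a x y : dot x (a *: y) = a * dot x y.
Proof. by rewrite /dot mulr_sumr; apply: eq_bigr => j _; rewrite mxE mulrCA. Qed.

Lemma dot_dir x i : dot x (dir i) = x ord0 i.
Proof.
rewrite /dot (bigD1 i)//= dirE eqxx mulr1 big1 ?addr0// => j /negbTE ji.
by rewrite dirE ji mulr0.
Qed.

Lemma sqn_dir i : sqn (dir i) = 1.
Proof.
rewrite /sqn (bigD1 i)//= dirE eqxx expr1n big1 ?addr0// => j /negbTE ji.
by rewrite dirE ji expr0n.
Qed.

Lemma enormZ a x : enorm (a *: x) = `|a| * enorm x.
Proof. by rewrite /enorm -/(sqn _) sqnZ sqrtrM ?sqr_ge0// sqrtr_sqr. Qed.

Lemma enorm_dir i : enorm (dir i) = 1.
Proof. by rewrite /enorm -/(sqn _) sqn_dir sqrtr1. Qed.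

Lemma enormN x : enorm (- x) = enorm x.
Proof. by rewrite -scaleN1r enormZ normrN normr1 mul1r. Qed.

Lemma enorm0 : enorm (0 : V) = 0.
Proof. by rewrite -(scale0r (0 : V)) enormZ normr0 mul0r. Qed.

Lemma coord_le_enorm x i : `|x ord0 i| <= enorm x.
Proof.
rewrite -sqrtr_sqr ler_wsqrtr// (bigD1 i)//= lerDl.
by apply: sumr_ge0 => j _; exact: sqr_ge0.
Qed.

Lemma enorm_eq0 x : enorm x = 0 -> x = 0.
Proof.
move=> x0; apply/rowP => i; rewrite mxE; apply/eqP.
by rewrite -normr_le0 -x0 coord_le_enorm.
Qed.

(** Cauchy-Schwarz: the square norm of [|y| x - |x| y] equals [2 |x| |y| (|x| |y| - x . y)]. *)
Lemma dot_le x y : dot x y <= enorm x * enorm y.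
Proof.
have [/enorm_eq0 ->|x0] := eqVneq (enorm x) 0.
  by rewrite -(scale0r (0 : V)) dotZl enormZ normr0 !mul0r.
have [/enorm_eq0 ->|y0] := eqVneq (enorm y) 0.
  by rewrite -(scale0r (0 : V)) dotZr enormZ normr0 !mul0r mulr0.
have {}x0 : 0 < enorm x by rewrite lt_neqAle eq_sym x0 enorm_ge0.
have {}y0 : 0 < enorm y by rewrite lt_neqAle eq_sym y0 enorm_ge0.
have := sqn_ge0 (enorm y *: x + (- enorm x) *: y).
rewrite sqnD !sqnZ dotZl dotZr -!sqr_enorm sqrrN.
have xy0 : 0 < enorm x * enorm y by exact: mulr_gt0.
rewrite (_ : _ + _ = 2 * (enorm x * enorm y) * (enorm x * enorm y - dot x y)); last by ring.
by rewrite pmulr_rge0 ?subr_ge0// mulr_gt0.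
Qed.

Lemma enormD x y : enorm (x + y) <= enorm x + enorm y.
Proof.
rewrite -(@ler_pXn2r _ 2) ?nnegrE ?addr_ge0 ?enorm_ge0//.
rewrite sqr_enorm sqnD sqrrD !sqr_enorm; have := dot_le x y.
by rewrite lerD2r lerD2l -mulr_natl; lra.
Qed.

(* This is [sqrt (A^2 + B) <= A + B / (2 A)] with [A^2 + B = |x + z|^2]. *)
Lemma enorm_tangent x z : 0 < enorm x ->
  enorm (x + z) <= enorm x + dot ((enorm x)^-1 *: x) z + sqn z / (2 * enorm x).
Proof.
move=> x0; rewrite dotZl; set A := enorm x; set S := dot x z; set Z := sqn z.
have AS : 0 <= A ^+ 2 + 2 * S + Z by rewrite /A sqr_enorm -sqnD sqn_ge0.
have E : A + A^-1 * S + Z / (2 * A) = (A ^+ 2 + (A ^+ 2 + 2 * S + Z)) / (2 * A).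
  by field; rewrite gt_eqF.
rewrite E -(@ler_pXn2r _ 2) ?nnegrE ?enorm_ge0//; last first.
  by apply: divr_ge0; [apply: addr_ge0 AS; exact: sqr_ge0|apply: mulr_ge0 (ltW x0)].
rewrite sqr_enorm sqnD -sqr_enorm -/A -/S -/Z.
move: AS; set Q := _ + _ + Z => Q0.
rewrite expr_div_n ler_pdivlMr ?exprn_gt0 ?mulr_gt0// -subr_ge0.
rewrite (_ : _ - _ = (A ^+ 2 - Q) ^+ 2) ?sqr_ge0//; by ring.
Qed.

End Euclid.

(** * The distance to the complement: Lipschitz bound, superdifferential, semiconcavity *)

Section Distance.
Variables (R : realType) (n : nat) (Om : set 'rV[R]_n).
Notation V := 'rV[R]_n.
Implicit Types (x y z v : V) (i j : 'I_n).
Hypothesis OmT : Om != [set: V].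
Notation d := (distc Om).

Let S x := [set enorm (x - y) | y in ~` Om].

Lemma distc_has_inf x : has_inf (S x).
Proof.
split; last by exists 0 => _ [y _ <-]; exact: enorm_ge0.
have [y yOm] : exists y, ~ Om y.
  by apply/existsNP => H; move/eqP: OmT; apply; apply/seteqP; split.
by exists (enorm (x - y)), y.
Qed.

Lemma distc_ge0 x : 0 <= d x.
Proof.
by apply: lb_le_inf; [exact: (distc_has_inf x).1|move=> _ [y _ <-]; exact: enorm_ge0].
Qed.

Lemma distc_le x y : ~ Om y -> d x <= enorm (x - y).
Proof. by move=> yOm; apply: ge_inf; [exact: (distc_has_inf x).2|exists y]. Qed.

Lemma distc_approx x e : 0 < e -> exists2 y, ~ Om y & enorm (x - y) < d x + e.
Proof.
by move=> e0; have [_ [y yOm <-] ?] := inf_adherent e0 (distc_has_inf x); exists y.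
Qed.

Lemma distc_lip x y : d x <= d y + enorm (x - y).
Proof.
apply/ler_addgt0Pl => e e0; have [z zOm yz] := distc_approx y e0.
apply: le_trans (distc_le _ zOm) _.
rewrite (_ : x - z = (x - y) + (y - z)); last by rewrite addrA subrK.
by apply: le_trans (enormD _ _) _; lra.
Qed.

Lemma distc_gt0_in x : 0 < d x -> Om x.
Proof.
by move=> dx; apply: contrapT => /(distc_le x); rewrite subrr enorm0 leNgt dx.
Qed.

Lemma distc_gt0 x : open Om -> Om x -> 0 < d x.
Proof.
move=> oOm Omx; have /nbhs_ballP[r /= r0 rOm] := open_nbhs_nbhs (conj oOm Omx).
apply: lt_le_trans r0 _; apply: lb_le_inf; first exact: (distc_has_inf x).1.
move=> _ [y yOm <-]; rewrite leNgt; apply/negP => xy; apply: yOm; apply: rOm.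
split=> [|i j]; first exact: le_lt_trans (enorm_ge0 _) xy.
rewrite ord1 /ball/=; apply: le_lt_trans xy.
by have := coord_le_enorm (x - y) j; rewrite !mxE.
Qed.

(** Let [y] be a nearly closest point of the complement, which costs [e]. The distance at [x + z] is
    at most [|x - y + z|], and [enorm_tangent] expands this with [p] the unit vector along [x - y];
    then [d x <= |x - y|] adjusts the quadratic term. *)
Lemma distc_superdiff x e : 0 < d x -> 0 < e -> exists2 p : V, sqn p = 1 &
  forall z, d (x + z) <= d x + e + dot p z + sqn z / (2 * d x).
Proof.
move=> dx e0; have [y yOm xy] := distc_approx x e0.
have dxy := distc_le x yOm.
have A0 : 0 < enorm (x - y) := lt_le_trans dx dxy.
exists ((enorm (x - y))^-1 *: (x - y)) => [|z].
  by rewrite sqnZ -sqr_enorm exprVn mulVf// expf_neq0// gt_eqF.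
apply: le_trans (distc_le _ yOm) _; rewrite addrAC.
apply: le_trans (enorm_tangent _ A0) _.
apply: lerD; first by rewrite lerD2r ltW.
rewrite ler_wpM2l ?sqn_ge0// lef_pV2 ?posrE ?mulr_gt0//.
by rewrite ler_pM2l.
Qed.

(** The superdifferential at the intermediate point is used with the increments [(1 - t) v] and
    [- t v]. With weights [t] and [1 - t] the linear terms cancel, and the quadratic ones add up
    because [t (1-t)^2 + (1-t) t^2 = t (1-t)]. A lower bound on the distance is thus required at the
    intermediate point only. *)
Lemma distc_semiconcave x v t m : 0 < m -> 0 <= t <= 1 -> m <= d (x + t *: v) ->
  t * d (x + v) + (1 - t) * d x <= d (x + t *: v) + t * (1 - t) * sqn v / (2 * m).
Proof.
move=> m0 /andP[t0 t1] md; apply/ler_addgt0Pl => e e0.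
have dx : 0 < d (x + t *: v) := lt_le_trans m0 md.
have [p _ H] := distc_superdiff dx e0.
have H1 := H ((1 - t) *: v); have H2 := H ((- t) *: v).
move: H1 H2; rewrite -!addrA -!scalerDl subrKC scale1r subrr scale0r addr0.
rewrite !dotZr !sqnZ sqrrN => H1 H2.
have Hm : sqn v / (2 * d (x + t *: v)) <= sqn v / (2 * m).
  rewrite ler_wpM2l ?sqn_ge0// lef_pV2 ?posrE ?mulr_gt0//.
  by rewrite ler_pM2l.
have Q0 : 0 <= sqn v / (2 * d (x + t *: v)).
  by rewrite divr_ge0 ?sqn_ge0// mulr_ge0// ltW.
have t10 : 0 <= t * (1 - t) by rewrite mulr_ge0// subr_ge0.
have H3 := ler_wpM2l t10 Hm.
have H4 := ler_wpM2l t0 H1.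
have t1' : 0 <= 1 - t by rewrite subr_ge0.
have H5 := ler_wpM2l t1' H2.
move: H3 H4 H5; rewrite -!mulrA; set Q := sqn v / _; set Q' := sqn v / _.
set a := d _; set b := d _; set c := d _; lra.
Qed.

End Distance.

(** * Mollification *)

Section PartialSupport.
Variables (R : realType) (n : nat).
Notation V := 'rV[R]_n.
Implicit Types (f g : V -> R) (x y z v : V) (i j : 'I_n) (A : set V).
Notation dir i := (delta_mx ord0 i : 'rV[R]_n).

Lemma ball_line x i (s h : R) : `|h| < s -> ball x s (x + h *: dir i).
Proof.
move=> hs; split=> [|k j]; first exact: le_lt_trans hs.
rewrite ord1 /ball/= [(x + _) _ _]mxE opprD addNKr normrN.
exact: le_lt_trans (norm_dir _ _ _) hs.
Qed.

Lemma is_derive_open A f g i x l : open A -> (forall y, A y -> f y = g y) -> A x ->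
  is_derive x (dir i) g l -> is_derive x (dir i) f l.
Proof.
move=> oA fg Ax; have /nbhs_ballP[s /= s0 sA] := open_nbhs_nbhs (conj oA Ax).
by apply: is_derive_near s0 _ => h hs; apply/fg/sA/ball_line.
Qed.

Lemma partial_open0 A f i : open A -> (forall x, A x -> f x = 0) ->
  forall x, A x -> partial i f x = 0.
Proof.
move=> oA f0 x Ax.
by have [_ ] := is_derive_open oA f0 Ax (is_derive_cstf x (dir i) 0).
Qed.

Lemma open_coord_gt K j : open [set x : V | K < `|x ord0 j|].
Proof.
apply: (@open_comp _ _ (fun x : V => `|x ord0 j|) [set t | K < t]); last exact: open_gt.
move=> x _; exact: (cvg_norm (@continuous_coord _ _ j x)).
Qed.

Lemma cc_partial K f i : smooth f -> cc K f -> cc K (partial i f).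
Proof.
move=> sf [_ f0]; split; first exact/smooth_continuous/smooth_partial.
move=> x j xj.
apply: (@partial_open0 [set y : V | K < `|y ord0 j|] f i _ _ x xj).
  exact: open_coord_gt.
by move=> y; exact: f0.
Qed.

End PartialSupport.

(** * The mollifier and the derivatives of mollified functions *)

Section Mollifier.
Variables (R : realType) (n : nat) (r : R).
Notation V := 'rV[R]_n.
Implicit Types (f g : V -> R) (x y z v : V) (i j : 'I_n).
Notation dir i := (delta_mx ord0 i : 'rV[R]_n).
Hypothesis r0 : 0 < r.

Definition rho x : R := beta 0 (r ^+ 2 - sqn x).

Lemma rho_smooth : smooth rho.
Proof. by apply: (@bump_class_smooth _ _ (r ^+ 2)); exact: bump_beta. Qed.

Lemma rho_ge0 x : 0 <= rho x. Proof. exact: beta_ge0. Qed.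

Lemma rho_supp x : r <= enorm x -> rho x = 0.
Proof.
move=> rx; rewrite /rho beta_le0// subr_le0 -sqr_enorm.
by rewrite lerXn2r// nnegrE ?enorm_ge0// ltW.
Qed.

Lemma rho_cc : cc r rho.
Proof.
split=> [|x i xi]; first exact/smooth_continuous/rho_smooth.
by apply/rho_supp/(le_trans (ltW xi))/coord_le_enorm.
Qed.

Lemma rho_Cc : Cc rho. Proof. by exists r; [exact: ltW|exact: rho_cc]. Qed.

Definition rmass : R := Int rho.

Lemma rmass_gt0 : 0 < rmass.
Proof.
have p0 : 0 < rho 0.
  rewrite /rho beta0_gt0// -sqr_enorm enorm0 expr0n subr0.
  exact: exprn_gt0.
have p20 : 0 < rho 0 / 2 by exact: divr_gt0.
have [d d0 H] := cc_unif (ltW r0) rho_cc p20.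
have d20 : 0 < d / 2 by exact: divr_gt0.
apply: (@lt_le_trans _ _ (rho 0 / 2 * (2 * (d / 2)) ^+ n)).
  by rewrite mulr_gt0// exprn_gt0// mulr_gt0.
apply: Int_lower => //; [exact: ltW|exact: ltW|exact: rho_Cc|exact: rho_ge0|].
move=> x xd; have /H : forall i, `|(0 : V) ord0 i - x ord0 i| < d.
  move=> i; rewrite mxE sub0r normrN; apply: le_lt_trans (xd i) _.
  by rewrite ltr_pdivrMr// ltr_pMr// ltr1n.
by rewrite ler_norml => /andP[_]; lra.
Qed.

(** A normalised positive linear functional. By [moll_avg] a mollification is an average of
    translates, so inequalities that hold on the ball of radius [r] pass to it. *)
Definition avg g : R := Int (fun y => rho y * g y) / rmass.

Lemma avg_lin a f g : continuous f -> continuous g ->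
  avg (fun y => a * f y + g y) = a * avg f + avg g.
Proof.
move=> fc gc; rewrite /avg mulrA -mulrDl -Int_lin; [|exact: CcM rho_Cc _..].
by congr (_ / _); apply: eqInt => y; ring.
Qed.

Lemma avg_cst c : avg (fun=> c) = c.
Proof.
rewrite /avg (eqInt (g := fun x => c * rho x)); last by move=> x; rewrite mulrC.
by rewrite IntZ ?mulfK//; [rewrite gt_eqF// rmass_gt0|exact: rho_Cc].
Qed.

Lemma avg_le f g : continuous f -> continuous g ->
  (forall y, enorm y < r -> f y <= g y) -> avg f <= avg g.
Proof.
move=> fc gc fg; rewrite ler_pM2r ?invr_gt0 ?rmass_gt0//.
apply: Int_le; [exact: CcM rho_Cc _..|] => y.
have [ry|yr] := leP r (enorm y); first by rewrite rho_supp// !mul0r.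
by apply: ler_wpM2l; [exact: rho_ge0|exact: fg].
Qed.

Section Smoothing.
Variables (f : V -> R) (B : R).
Hypotheses (fc : continuous f) (fB : forall x, `|f x| <= B).

Definition moll z : R := conv f rho z / rmass.

(** The derivatives act on the kernel, since [f] is merely continuous; the sign comes from the
    convention in [conv] and cancels in [ddmoll]. *)
Definition dmoll i z : R := - conv f (partial i rho) z / rmass.

Definition ddmoll i z : R := conv f (partial i (partial i rho)) z / rmass.

Let rK i : cc r (partial i rho).
Proof. by apply: cc_partial; [exact: rho_smooth|exact: rho_cc]. Qed.

Let rKK i : cc r (partial i (partial i rho)).
Proof. by apply: cc_partial => //; apply/smooth_partial/rho_smooth. Qed.

Lemma moll_avg z : moll z = avg (fun y => f (y + z)).
Proof. by rewrite /moll convE//; exact: rho_Cc. Qed.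

Lemma continuous_moll : continuous moll.
Proof.
apply: (continuous_mulf (g := fun=> rmass^-1)); last exact: cst_continuous.
exact: continuous_conv (ltW r0) fc fB rho_cc.
Qed.

Lemma continuous_dmoll i : continuous (dmoll i).
Proof.
rewrite (_ : dmoll i = fun z => conv f (partial i rho) z * - rmass^-1).
  apply: (continuous_mulf (g := fun=> - rmass^-1)); last exact: cst_continuous.
  exact: continuous_conv (ltW r0) fc fB (rK i).
by apply/funext => z; rewrite /dmoll mulrN mulNr.
Qed.

Lemma continuous_ddmoll i : continuous (ddmoll i).
Proof.
apply: (continuous_mulf (g := fun=> rmass^-1)); last exact: cst_continuous.
exact: continuous_conv (ltW r0) fc fB (rKK i).
Qed.

Lemma is_derive_moll i z : is_derive z (dir i) moll (dmoll i z).
Proof.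
have H : is_derive z (dir i) (conv f rho) (- conv f (partial i rho) z).
  apply: is_derive_conv (ltW r0) fc fB rho_cc _ (rK i) => x.
  exact/smooth_derivable/rho_smooth.
apply: is_derive_eq (is_derive_mulf H (is_derive_cstf z _ rmass^-1)) _.
by rewrite mulr0 add0r mulrC.
Qed.

Lemma is_derive_dmoll i z : is_derive z (dir i) (dmoll i) (ddmoll i z).
Proof.
have H : is_derive z (dir i) (conv f (partial i rho))
    (- conv f (partial i (partial i rho)) z).
  apply: is_derive_conv (ltW r0) fc fB (rK i) _ (rKK i) => x.
  exact/smooth_derivable/smooth_partial/rho_smooth.
rewrite (_ : dmoll i = fun z => conv f (partial i rho) z * - rmass^-1).
  apply: is_derive_eq (is_derive_mulf H (is_derive_cstf z _ (- rmass^-1))) _.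
  by rewrite mulr0 add0r mulrNN mulrC.
by apply/funext => y; rewrite /dmoll mulrN mulNr.
Qed.

Let fs z : continuous (fun y => f (y + z)).
Proof. exact: (@continuous_shiftr _ _ f z). Qed.

Lemma moll_ge c z : (forall x, c <= f x) -> c <= moll z.
Proof.
move=> cf; rewrite moll_avg -[leLHS]avg_cst.
by apply: avg_le => //; exact: cst_continuous.
Qed.

Lemma moll_le c z : (forall x, f x <= c) -> moll z <= c.
Proof.
move=> cf; rewrite moll_avg -[leRHS]avg_cst.
by apply: avg_le => //; exact: cst_continuous.
Qed.

Section Lipschitz.
Hypothesis flip : forall x y, f x <= f y + enorm (x - y).

Lemma lip_norm x y : `|f x - f y| <= enorm (x - y).
Proof.
have := flip x y; have := flip y x.
rewrite -(enormN (y - x)) opprB => h1 h2.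
by rewrite ler_norml; apply/andP; split; lra.
Qed.

Lemma moll_close z : `|moll z - f z| <= r.
Proof.
have A y : enorm y < r -> `|f (y + z) - f z| <= r.
  by move=> yr; apply: le_trans (lip_norm _ _) _; rewrite addrK ltW.
rewrite ler_norml moll_avg; apply/andP; split.
  rewrite lerBrDr -[leLHS]avg_cst; apply: avg_le => //; first exact: cst_continuous.
  by move=> y /A; rewrite ler_norml => /andP[]; lra.
rewrite lerBlDr -[leRHS]avg_cst; apply: avg_le => //; first exact: cst_continuous.
by move=> y /A; rewrite ler_norml => /andP[]; lra.
Qed.

Lemma moll_lip x y : moll x - moll y <= enorm (x - y).
Proof.
rewrite -[leRHS]avg_cst !moll_avg lerBlDr.
rewrite (_ : _ + _ = 1 * avg (fun=> enorm (x - y)) + avg (fun z => f (z + y))); last by rewrite mul1r.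
rewrite -avg_lin//; last exact: cst_continuous.
apply: avg_le => //.
  by apply: (continuous_addf (f := fun=> 1 * enorm (x - y))) => //; exact: cst_continuous.
move=> z _; rewrite mul1r [leRHS]addrC.
rewrite (_ : x - y = (z + x) - (z + y)); first exact: flip.
by rewrite opprD addrACA subrr add0r.
Qed.

Lemma dmoll_le1 i z : `|dmoll i z| <= 1.
Proof.
apply/ler_addgt0Pl => e e0.
have [s s0 H] := (is_deriveP _ _ _ _).1 (is_derive_moll i z) e e0.
have s20 : 0 < s / 2 by exact: divr_gt0.
have {}H := H (s / 2) (lt0r_neq0 s20).
have {}H : `|(moll (z + (s / 2) *: dir i) - moll z) / (s / 2) - dmoll i z| <= e.
  by apply: H; rewrite gtr0_norm// ltr_pdivrMr// ltr_pMr// ltr1n.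
have Q : `|(moll (z + (s / 2) *: dir i) - moll z) / (s / 2)| <= 1.
  rewrite normrM (gtr0_norm (x := _^-1)) ?invr_gt0// ler_pdivrMr// mul1r.
  have E : enorm ((s / 2) *: dir i) = s / 2 by rewrite enormZ enorm_dir mulr1 gtr0_norm.
  have := moll_lip z (z + (s / 2) *: dir i); have := moll_lip (z + (s / 2) *: dir i) z.
  rewrite opprD addNKr enormN addrAC subrr add0r E => h1 h2.
  by rewrite ler_norml; apply/andP; split; lra.
rewrite -[dmoll i z](subKr ((moll (z + (s / 2) *: dir i) - moll z) / (s / 2))).
by rewrite (le_trans (ler_normB _ _))// addrC lerD.
Qed.

End Lipschitz.

(* A one-sided second-difference bound passes to the average, and letting the
   convexity parameter tend to 0 it bounds the derivative of the average. *)
Lemma dmoll_semiconcave (C h : R) i z :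
  (forall y (t : R), enorm y < r -> 0 <= t <= 1 ->
     t * f (y + z + h *: dir i) + (1 - t) * f (y + z) <=
     f (y + z + t *: (h *: dir i)) + t * (1 - t) * C) ->
  moll (z + h *: dir i) - moll z <= h * dmoll i z + C.
Proof.
move=> sc.
have scm (t : R) : 0 <= t <= 1 -> t * moll (z + h *: dir i) + (1 - t) * moll z <=
    moll (z + t *: (h *: dir i)) + t * (1 - t) * C.
  move=> t01; rewrite !moll_avg -(avg_cst (t * (1 - t) * C)).
  have c1 a : continuous (fun y : V => f (y + a)) by [].
  have c2 : continuous (fun y : V => (1 - t) * f (y + z)).
    by apply: (continuous_mulf (f := fun=> 1 - t)) => //; exact: cst_continuous.
  have c3 : continuous (fun y : V => t * f (y + (z + h *: dir i))).
    by apply: (continuous_mulf (f := fun=> t)) => //; exact: cst_continuous.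
  have cc0 : continuous (fun _ : V => t * (1 - t) * C) by exact: cst_continuous.
  have E : (1 - t) * avg (fun y => f (y + z)) = avg (fun y => (1 - t) * f (y + z)).
    have := avg_lin (1 - t) (c1 z) (@cst_continuous V R (0 : R)).
    rewrite avg_cst addr0 => <-.
    by congr avg; apply/funext => y; rewrite addr0.
  rewrite E -avg_lin// -[X in _ <= X + _]mul1r -avg_lin//.
  apply: avg_le.
  - exact: continuous_addf.
  - apply: (continuous_addf (f := fun y => 1 * f (y + (z + t *: (h *: dir i)))) (g := fun=> t * (1 - t) * C)) => //.
    by apply: (continuous_mulf (f := fun=> 1)) => //; exact: cst_continuous.
  - by move=> y yr; rewrite mul1r !addrA; exact: sc.
apply/ler_addgt0Pl => e e0.
pose D := `|h| + `|C| + 1; have D0 : 0 < D by rewrite ltr_wpDl// addr_ge0.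
have [s s0 H] := (is_deriveP _ _ _ _).1 (is_derive_moll i z) _ (divr_gt0 e0 D0).
(* The bound [t * D <= s / 2] puts the step [t * h] within the range of [H]. The bound [t <= e / D]
   makes the error left after division by [t], namely [|h| e / D + t |C|], at most [e]. *)
pose t := Num.min (Num.min 1 (s / 2 / D)) (e / D).
have sD0 : 0 < s / 2 / D by apply: divr_gt0 => //; exact: divr_gt0.
have eD0 : 0 < e / D by exact: divr_gt0.
have t0 : 0 < t by rewrite !lt_min ltr01 sD0 eD0.
have t1 : t <= 1 by rewrite !ge_min lexx.
have tD : t * D <= s / 2 by rewrite -ler_pdivlMr// !ge_min lexx orbT.
have teD : t * D <= e by rewrite -ler_pdivlMr// ge_min lexx orbT.
have [h0|hn0] := eqVneq h 0.
  rewrite h0 scale0r addr0 subrr mul0r add0r.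
  have h1 : 0 <= (1 / 2 : R) <= 1 by apply/andP; split; lra.
  have := scm _ h1; rewrite h0 scale0r scaler0 addr0; lra.
have htn0 : t * h != 0 by rewrite mulf_neq0// gt_eqF.
have hts : `|t * h| < s.
  rewrite normrM gtr0_norm//; apply: (@le_lt_trans _ _ (s / 2)).
    apply: le_trans tD; rewrite ler_pM2l// /D -addrA lerDl addr_ge0//.
  by rewrite ltr_pdivrMr// ltr_pMr// ltr1n.
have := scm t; rewrite (ltW t0) t1 => /(_ isT); rewrite scalerA.
have := H _ htn0 hts.
set a := moll (z + h *: _); set b := moll (z + _); set c := moll z; set p := dmoll i z.
move=> Hq Hs.
have {}Hq : b - c <= t * (h * p) + t * (`|h| * (e / D)).
  have E : b - c - t * (h * p) = t * h * ((b - c) / (t * h) - p).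
    by field; rewrite hn0 gt_eqF.
  rewrite -lerBlDl E; apply: le_trans (ler_norm _) _.
  by rewrite normrM normrM (gtr0_norm t0) -mulrA ler_pM2l//; exact: ler_wpM2l.
have ht : t * (a - c) <= t * (h * p + C + (`|h| * (e / D) + t * `|C|)).
  have C1 : - C <= `|C| by rewrite -normrN ler_norm.
  have := ler_wpM2l (mulr_ge0 (ltW t0) (ltW t0)) C1; lra.
move: ht; rewrite ler_pM2l// => ht.
have te : t <= e / D by rewrite ler_pdivlMr.
have tC' : t * `|C| <= e / D * `|C| by exact: ler_wpM2r.
have eD : e / D * (`|h| + `|C|) <= e.
  by rewrite -[leRHS](divfK (lt0r_neq0 D0)) ler_pM2l// /D lerDl.
by move: ht eD; rewrite mulrDr; lra.
Qed.

End Smoothing.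
End Mollifier.

(** * Superharmonicity of the mollified distance *)

Section Superharmonic.
Variables (R : realType) (n : nat) (Om : set 'rV[R]_n) (r : R).
Notation V := 'rV[R]_n.
Implicit Types (f g : V -> R) (x y z v : V) (i j : 'I_n).
Notation dir i := (delta_mx ord0 i : 'rV[R]_n).
Hypothesis r0 : 0 < r.
Notation d := (distc Om).
Notation rho := (@rho R n r).

Lemma laplacian_rho_Cc : Cc (laplacian rho).
Proof.
apply: Cc_sum => i; exists r; first exact: ltW.
apply: cc_partial; first exact/smooth_partial/rho_smooth.
by apply: cc_partial; [exact: rho_smooth|exact: rho_cc].
Qed.

Lemma laplacian_shiftf f y : smooth f ->
  laplacian (fun x => f (x + y)) = fun x => laplacian f (x + y).
Proof.
move=> sf; apply/funext => x; apply: eq_bigr => i _.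
rewrite partial_shiftf; last by move=> z; exact: smooth_derivable.
rewrite partial_shiftf// => z; apply: smooth_derivable; exact: smooth_partial.
Qed.

Lemma laplacian_rho_supp x : r < enorm x -> laplacian rho x = 0.
Proof.
move=> rx; pose A := [set x : V | r ^+ 2 < sqn x].
have oA : open A.
  apply: (@open_comp _ _ (@sqn R n) [set t | r ^+ 2 < t]); last exact: open_gt.
  by move=> y _; exact: continuous_sqn.
have Ax : A x by rewrite /A/= -sqr_enorm ltr_pXn2r// nnegrE ?enorm_ge0// ltW.
apply: big1 => i _; apply: (@partial_open0 R n A _ i oA _ x Ax) => y Ay.
apply: (@partial_open0 R n A _ i oA _ y Ay) => z.
rewrite /A/= -sqr_enorm ltr_pXn2r ?nnegrE ?enorm_ge0 ?(ltW r0)// => /ltW.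
by apply: rho_supp.
Qed.

Lemma rho_test z : (forall y, enorm (y - z) <= r -> Om y) ->
  Cc_infty Om (fun y => rho (y - z)).
Proof.
move=> BOm; split; first by apply: smooth_shiftf; exact: rho_smooth.
pose A := [set y | sqn (y - z) <= r ^+ 2].
have cA : closed A.
  apply: (@closed_comp _ _ (fun y => sqn (y - z)) [set t | t <= r ^+ 2]); last exact: closed_le.
  by move=> y _; apply: (@continuous_shiftr _ _ _ (- z)); exact: continuous_sqn.
have AE y : A y <-> enorm (y - z) <= r.
  by rewrite /A/= -sqr_enorm ler_pXn2r// nnegrE ?enorm_ge0// ltW.
have sA : closure [set y | rho (y - z) != 0] `<=` A.
  rewrite [X in _ `<=` X](iffLR (closure_id A) cA); apply: closure_subset => y /=.
  by move=> ry; apply/AE; rewrite leNgt; apply: contra ry => /ltW/(rho_supp r0) ->.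
split; last by move=> y /sA/AE/BOm.
apply: (@subclosed_compact _ _ A) => //; first exact: closed_closure.
apply: bounded_closed_compact cA; exists (r + enorm z); split; first exact: num_real.
move=> t rt y /AE yr; apply: le_trans (ltW rt).
rewrite [leLHS]/Num.norm/= mx_normrE; apply/bigmax_leP; split.
  by rewrite addr_ge0 ?enorm_ge0// ltW.
move=> [k j] _ /=; rewrite ord1; apply: le_trans (coord_le_enorm _ _) _.
rewrite -[y in enorm y](subrK z); apply: le_trans (enormD _ _) _.
by rewrite lerD2r.
Qed.

(** The Laplacian of the mollification at [z] is, up to the mass, the integral of [f] against the
    Laplacian of the kernel centred at [z], an admissible test function because the closed ball lies
    in [Om]. Outside that ball the Laplacian of the kernel vanishes, so [f] may differ from [d]
    there. *)
Lemma moll_superharmonic f z : continuous f -> neg_laplacian_nonneg Om d ->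
  (forall y, enorm (y - z) <= r -> Om y /\ f y = d y) ->
  \sum_i ddmoll r f i z <= 0.
Proof.
move=> fc sh fd; rewrite /ddmoll -mulr_suml pmulr_lle0 ?invr_gt0 ?rmass_gt0//.
have pc i : Cc (partial i (partial i rho)).
  exists r; first exact: ltW.
  apply: cc_partial; first exact/smooth_partial/rho_smooth.
  by apply: cc_partial; [exact: rho_smooth|exact: rho_cc].
have -> : \sum_i conv f (partial i (partial i rho)) z =
    Int (fun x => f x * laplacian rho (x - z)).
  rewrite /conv -Int_sum; last by move=> i; exact: conv_Cc.
  by apply: eqInt => x; rewrite mulr_sumr.
have := sh _ (rho_test (fun y h => (fd y h).1)) (fun x => rho_ge0 r _).
rewrite laplacian_shiftf; last exact: rho_smooth.
rewrite (_ : (fun _ => _) = fun x => (f x * laplacian rho (x - z))%:E).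
  by rewrite intRn_Cc ?lee_fin//; apply: conv_Cc => //; exact: laplacian_rho_Cc.
apply/funext => x; congr (_%:E).
have [xr|rx] := leP (enorm (x - z)) r; first by rewrite (fd x xr).2.
by rewrite laplacian_rho_supp// !mulr0.
Qed.

End Superharmonic.

(** * The inequality for mollified weights *)

Lemma Cc_continuous (R : realType) n (f : 'rV[R]_n -> R) : Cc f -> continuous f.
Proof. by move=> [K _ []]. Qed.

Section FinitePos.
Variable R : realType.

Lemma finite_pos_bound n (Q : 'I_n -> R -> Prop) :
  (forall i, exists2 d, 0 < d & Q i d) ->
  (forall i d d', 0 < d' -> d' <= d -> Q i d -> Q i d') ->
  exists2 d, 0 < d & forall i, Q i d.
Proof.
move=> H mono; have /choice[d dP] : forall i, exists d, 0 < d /\ Q i d.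
  by move=> i; have [d ? ?] := H i; exists d.
(* The initial value [1] keeps the minimum positive when there is no index. *)
exists (\big[Num.min/1]_i d i) => [|i].
  by apply: lt_bigmin => // i _; have [] := dP i.
have [? Qi] := dP i; apply: mono Qi; last exact: bigmin_le.
by apply: lt_bigmin => // j _; have [] := dP j.
Qed.

End FinitePos.

Section Pointwise.
Variables (R : realType) (n : nat).
Notation V := 'rV[R]_n.

(* Replaces the gradient [q] of the mollification by the unit vector [p]; the
   roles are [a = - F'(P)], [b = F(P)], [c = phi] and [g = grad phi]. *)
Lemma chain_rule_bound (p q g : V) (E : 'I_n -> R) (a b c M : R) :
  sqn p = 1 -> 0 <= a <= M -> 0 <= b <= M -> 0 <= c ->
  (forall i, `|q ord0 i| <= 1) -> (forall i, `|p ord0 i - q ord0 i| <= E i) ->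
  - a * c * sqn q + b * dot g q <=
  - (a * c) + b * enorm g + M * \sum_i (2 * c + `|g ord0 i|) * E i.
Proof.
move=> p1 /andP[a0 aM] /andP[b0 bM] c0 q1 pq.
have E0 i : 0 <= E i := le_trans (normr_ge0 _) (pq i).
have p1' i : `|p ord0 i| <= 1.
  have <- : enorm p = 1 by rewrite /enorm -/(sqn _) p1 sqrtr1.
  exact: coord_le_enorm.
(* As [|p| = 1], the left side is the sum of [(p_i - q_i) (p_i + q_i)], with second factors at most
   [2] in absolute value. *)
have H1 : 1 - sqn q <= \sum_i 2 * E i.
  rewrite -p1 -sumrB; apply: ler_sum => i _; rewrite subr_sqr mulrC.
  apply: le_trans (ler_norm _) _; rewrite normrM; apply: ler_pM => //.
  by apply: le_trans (ler_normD _ _) _; move: (p1' i) (q1 i); lra.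
have H2 : dot g q <= enorm g + \sum_i `|g ord0 i| * E i.
  have -> : dot g q = dot g p + \sum_i g ord0 i * (q ord0 i - p ord0 i).
    by rewrite -big_split; apply: eq_bigr => i _ /=; ring.
  apply: lerD.
    by apply: le_trans (dot_le _ _) _; rewrite [X in _ * X]/enorm -/(sqn _) p1 sqrtr1 mulr1.
  apply: ler_sum => i _; apply: le_trans (ler_norm _) _; rewrite normrM ler_wpM2l//.
  by rewrite distrC.
have s1 : 0 <= \sum_i 2 * E i by apply: sumr_ge0 => i _; rewrite mulr_ge0.
have s2 : 0 <= \sum_i `|g ord0 i| * E i by apply: sumr_ge0 => i _; rewrite mulr_ge0.
have -> : \sum_i (2 * c + `|g ord0 i|) * E i = c * (\sum_i 2 * E i) + \sum_i `|g ord0 i| * E i.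
  by rewrite mulr_sumr -big_split; apply: eq_bigr => i _ /=; ring.
have K1 := ler_wpM2l (mulr_ge0 a0 c0) H1.
have K2 := ler_wpM2l b0 H2.
have K3 := ler_wpM2r (mulr_ge0 c0 s1) aM.
have K4 := ler_wpM2r s2 bM.
move: K1 K2 K3 K4; set X := \sum_i 2 * E i; set Y := \sum_i _; lra.
Qed.

End Pointwise.

Section WeightedInequality.
Variables (R : realType) (n : nat) (Om : set 'rV[R]_n).
Notation V := 'rV[R]_n.
Implicit Types (x y z v : V) (i j : 'I_n).
Notation dir i := (delta_mx ord0 i : 'rV[R]_n).
Notation d := (distc Om).

Hypothesis OmT : Om != [set: V].
Hypothesis sh : neg_laplacian_nonneg Om d.

Variables (Rd m : R).
Hypotheses (m0 : 0 < m) (mRd : m <= Rd) (dRd : forall x, d x <= Rd).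

(** The cut-off keeps the argument of the weight in [[m, Rd]] on the whole space, away from the
    singularity at [0]; near the support of the test function it changes nothing. *)
Definition trunc x : R := Num.max (d x) m.
Notation f := trunc.

Lemma trunc_ge x : m <= f x.
Proof. by rewrite /trunc le_max lexx orbT. Qed.

Lemma trunc_le x : f x <= Rd.
Proof. by rewrite /trunc ge_max dRd mRd. Qed.

Lemma truncE x : m <= d x -> f x = d x.
Proof. by rewrite /trunc => /max_idPl. Qed.

Lemma dist_trunc x : d x <= f x.
Proof. by rewrite /trunc le_max lexx. Qed.

Lemma trunc_lip x y : f x <= f y + enorm (x - y).
Proof.
rewrite {1}/trunc ge_max; apply/andP; split.
  by apply: le_trans (distc_lip OmT x y) _; rewrite lerD2r dist_trunc.
by rewrite ler_wpDr ?enorm_ge0// trunc_ge.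
Qed.

Lemma trunc_bound x : `|f x| <= Rd.
Proof. by rewrite ger0_norm ?trunc_le// (le_trans (ltW m0))// trunc_ge. Qed.

Lemma enorm_le_sum x : enorm x <= \sum_i `|x ord0 i|.
Proof.
have s0 : 0 <= \sum_i `|x ord0 i| by exact: sumr_ge0.
rewrite -(@ler_pXn2r _ 2) ?nnegrE ?enorm_ge0// sqr_enorm expr2 mulr_suml.
apply: ler_sum => i _; rewrite -real_normK ?num_real// expr2 ler_wpM2l//.
by rewrite (bigD1 i)//= lerDl sumr_ge0.
Qed.

Lemma continuous_trunc : continuous f.
Proof.
suff ct (z : V) : f y @[y --> z] --> f z by exact: ct.
apply/(@cvgrPdist_le _ _ _ _ (nbhs_filter z)) => e e0.
(* Balls of the space are those of the sup norm, whose radius bounds each of the [n] coordinates;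
   the extra [1] covers [n = 0]. *)
have N0 : 0 < n%:R + 1 :> R by rewrite ltr_wpDl.
apply/nbhs_ballP; exists (e / (n%:R + 1)) => [|y [_ zy]] /=; first exact: divr_gt0.
apply: le_trans (lip_norm trunc_lip _ _) _.
apply: le_trans (enorm_le_sum _) _.
apply: (@le_trans _ _ (\sum_(i < n) e / (n%:R + 1))).
  apply: ler_sum => i _; apply: ltW; have := zy ord0 i.
  by rewrite /ball/= !mxE.
rewrite sumr_const card_ord -[X in X <= _]mulr_natr -mulrA ler_piMr ?(ltW e0)//.
by rewrite mulrC ler_pdivrMr// mul1r lerDl.
Qed.

(** * The inequality with an explicit error, for fixed radius [r] and step [h] *)

Section Step.
Variables (phi : V -> R) (dphi : 'I_n -> V -> R) (A : set V).
Hypotheses (phic : Cc phi) (phi0 : forall x, 0 <= phi x)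
  (dphiP : forall i x, is_derive x (dir i) phi (dphi i x))
  (dphic : forall i, Cc (dphi i))
  (Ad : forall x, A x -> 4 * m <= d x)
  (phiA : forall x, ~ A x -> phi x = 0)
  (dphiA : forall i x, ~ A x -> dphi i x = 0).
Variables (F F1 : R -> R) (M : R).
Hypotheses (FP : forall t, m <= t <= Rd -> is_derive t (1 : R) F (F1 t))
  (F1c : forall t, m <= t <= Rd -> {for t, continuous F1})
  (F0 : forall t, m <= t <= Rd -> 0 <= F t <= M)
  (F10 : forall t, m <= t <= Rd -> 0 <= - F1 t <= M).

Variables (r h : R).
Hypotheses (r0 : 0 < r) (rm : r <= m) (h0 : 0 < h) (hm : h <= m).

Notation P := (moll r f).
Notation q := (dmoll r f).

Let Pm x : m <= P x <= Rd.
Proof.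
apply/andP; split.
  by apply: moll_ge => //; [exact: continuous_trunc|exact: trunc_ge].
by apply: moll_le => //; [exact: continuous_trunc|exact: trunc_le].
Qed.

(** The term [2 * r] pays for replacing the mollification by [f] at two points, and
    [h ^+ 2 / (2 * m)] is the quadratic term of semiconcavity; division by [h] turns both into an
    error on slopes. *)
Let slack : R := (2 * r + h ^+ 2 / (2 * m)) / h.

(** Backward minus forward difference quotient, plus [slack] at either end. *)
Let err i x : R := (2 * f x - f (x + h *: dir i) - f (x - h *: dir i)) / h + 2 * slack.

(** Explains the factor [4] in [Ad]: the distance loses at most [3 * m] along a shift of that
    length. The shifts that occur have length at most [r + h <= 2 * m]. *)
Let near_d x v : A x -> enorm v <= 3 * m -> f (x + v) = d (x + v) /\ m <= d (x + v).
Proof.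
move=> Ax vm; have := distc_lip OmT x (x + v).
rewrite opprD addNKr enormN => H; have H4 := Ad Ax.
have dm : m <= d (x + v) by lra.
by rewrite truncE.
Qed.

Let enorm_hdir i (s : R) : enorm (s *: dir i) = `|s|.
Proof. by rewrite enormZ enorm_dir mulr1. Qed.

(** A slope [l] with [f(x + s e_i) - f(x) <= s l + h slack] for both [s = h] and [s = -h] lies in an
    interval of length [err i x]; the components of [p] and of the gradient are two such slopes. *)
Lemma grad_moll_close x : A x -> exists2 p : V, sqn p = 1 &
  forall i, `|p ord0 i - q i x| <= err i x.
Proof.
move=> Ax.
have fx : f x = d x.
  by have := @near_d x 0 Ax; rewrite addr0 enorm0 mulr_ge0 ?(ltW m0)// => /(_ isT)[].
have dx : 4 * m <= d x by exact: Ad.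
have dx0 : 0 < d x by apply: lt_le_trans dx; rewrite mulr_gt0.
have [p p1 pP] := distc_superdiff OmT dx0 r0.
exists p => // i.
have C0 : 0 <= h ^+ 2 / (2 * m) by rewrite divr_ge0 ?sqr_ge0// mulr_ge0// ltW.
have pb (s : R) : `|s| = h -> f (x + s *: dir i) - f x <= s * p ord0 i + (2 * r + h ^+ 2 / (2 * m)).
  move=> sh'; have sm : enorm (s *: dir i) <= 3 * m.
    rewrite enorm_hdir sh'. move: hm m0 h0; lra.
  have [-> _] := near_d Ax sm; rewrite fx.
  have := pP (s *: dir i); rewrite dotZr dot_dir sqnZ sqn_dir mulr1.
  rewrite -(real_normK (num_real s)) sh'.
  have : h ^+ 2 / (2 * d x) <= h ^+ 2 / (2 * m).
    rewrite ler_wpM2l ?sqr_ge0// lef_pV2 ?posrE ?mulr_gt0//.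
    by rewrite ler_pM2l//; move: dx m0; lra.
  by move: r0; lra.
have close z : `|P z - f z| <= r.
  exact: (moll_close r0 continuous_trunc trunc_lip).
(* The bound is shown for the mollification by averaging semiconcavity over the points [y] of the
   ball, all within [r + h] of [x] after translation; [close] then replaces [P] by [f] twice. *)
have qb (s : R) : `|s| = h -> f (x + s *: dir i) - f x <= s * q i x + (2 * r + h ^+ 2 / (2 * m)).
  move=> sh'.
  have := @dmoll_semiconcave R n r r0 f Rd continuous_trunc trunc_bound (h ^+ 2 / (2 * m)) s i x.
  have := close x; have := close (x + s *: dir i).
  rewrite !ler_norml => /andP[k1 k2] /andP[k3 k4] H.
  suff : P (x + s *: dir i) - P x <= s * q i x + h ^+ 2 / (2 * m) by lra.
  apply: H => y t yr t01; have /andP[t0 t1] := t01.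
  have N (a : R) : 0 <= a <= 1 -> enorm (y + (a * s) *: dir i) <= 3 * m.
    move=> /andP[a0 a1]; apply: le_trans (enormD _ _) _.
    rewrite enorm_hdir normrM sh' ger0_norm//.
    have : a * h <= h by rewrite ler_piMl// ltW.
    by move: yr rm hm; lra.
  have yx : y + x = x + y by rewrite addrC.
  have z1 : 0 <= (1 : R) <= 1 by rewrite ler01 lexx.
  have z0 : 0 <= (0 : R) <= 1 by rewrite ler01 lexx.
  have [e1 _] := near_d Ax (N 1 z1).
  have [e2 _] := near_d Ax (N 0 z0).
  have [e3 e4] := near_d Ax (N t t01).
  move: e1 e2 e3 e4; rewrite mul1r mul0r scale0r addr0 !addrA -yx -scalerA => -> -> -> e4.
  have := distc_semiconcave OmT m0 t01 e4.
  by rewrite sqnZ sqn_dir mulr1 -(real_normK (num_real s)) sh' mulrA.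
have hh : `|h| = h by rewrite gtr0_norm.
have hN : `|- h| = h by rewrite normrN.
have := pb h hh; have := pb _ hN; have := qb h hh; have := qb _ hN.
rewrite scaleNr.
set a := f (x + h *: dir i); set b := f (x - h *: dir i); set c := f x.
set S := 2 * r + h ^+ 2 / (2 * m).
move=> q1 q2 p1' p2.
rewrite -(ler_pM2l h0) /err /slack -/a -/b -/c -/S.
rewrite -{1}hh -normrM ler_norml (_ : h * _ = 2 * c - a - b + 2 * S); last by field; rewrite gt_eqF.
by apply/andP; split; lra.
Qed.

(** Component [i] of the field [F(P) phi grad P]; [dpsi] keeps its second-order term apart, as the
    summand that will be discarded by sign. *)
Let psi i x : R := F (P x) * (phi x * q i x).

Let dpsi i x : R := F1 (P x) * phi x * q i x ^+ 2 + F (P x) * (dphi i x * q i x) +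
  F (P x) * phi x * ddmoll r f i x.

Let FPc : continuous (fun x => F (P x)).
Proof.
move=> x; have cF : {for P x, continuous F}.
  by apply/differentiable_continuous/derivable1_diffP; have [] := FP (Pm x).
have cP := @continuous_moll R n r r0 f Rd continuous_trunc trunc_bound x.
exact: (cvg_comp _ _ cP cF).
Qed.

Let F1Pc : continuous (fun x => F1 (P x)).
Proof.
move=> x; have cF := F1c (Pm x).
have cP := @continuous_moll R n r r0 f Rd continuous_trunc trunc_bound x.
exact: (cvg_comp _ _ cP cF).
Qed.

Let qc i : continuous (q i) := @continuous_dmoll R n r r0 f Rd continuous_trunc trunc_bound i.

Let ddc i : continuous (ddmoll r f i) :=
  @continuous_ddmoll R n r r0 f Rd continuous_trunc trunc_bound i.

Let psi_d i x : is_derive x (dir i) (psi i) (dpsi i x).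
Proof.
have dP := @is_derive_moll R n r r0 f Rd continuous_trunc trunc_bound i x.
have dq := @is_derive_dmoll R n r r0 f Rd continuous_trunc trunc_bound i x.
have dF := is_derive_comp dP (FP (Pm x)).
apply: is_derive_eq (is_derive_mulf dF (is_derive_mulf (dphiP i x) dq)) _.
by rewrite /dpsi; ring.
Qed.

Let c1 i : Cc (fun x => F1 (P x) * phi x * q i x ^+ 2).
Proof.
have := CcM (CcM (CcM phic F1Pc) (@qc i)) (@qc i).
by apply: eqCc => x; ring.
Qed.

Let c2 i : Cc (fun x => F (P x) * (dphi i x * q i x)).
Proof. by have := CcM (CcM (dphic i) FPc) (@qc i); apply: eqCc => x; ring. Qed.

Let c3 i : Cc (fun x => F (P x) * phi x * ddmoll r f i x).
Proof. by have := CcM (CcM phic FPc) (@ddc i); apply: eqCc => x; ring. Qed.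

Let c12 i := CcD (c1 i) (c2 i).

Lemma Int_dpsi i : Int (dpsi i) = 0.
Proof.
have pd : partial i (psi i) = dpsi i.
  by apply/funext => x; rewrite /partial; have [_ ->] := psi_d i x.
have cpsi : Cc (psi i).
  by have := CcM (CcM phic FPc) (@qc i); apply: eqCc => x; rewrite /psi; ring.
have cd : Cc (dpsi i) := CcD (c12 i) (c3 i).
have [K K0 Kp] := cpsi; have [L L0 Lp] := cd.
rewrite -pd; apply: (@Int_partial R n (K + L)).
- exact: addr_ge0.
- by apply: cc_mono Kp; rewrite lerDl.
- by move=> x; have [] := psi_d i x.
- by rewrite pd; apply: cc_mono Lp; rewrite lerDr.
Qed.

Definition grad x : V := \row_i dphi i x.

(* Integration by parts of [div (F(P) phi grad P)], dropping the term in
   [Delta P <= 0]. *)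
Lemma superharmonic_test :
  0 <= Int (fun x => \sum_i (F1 (P x) * phi x * q i x ^+ 2 + F (P x) * (dphi i x * q i x))).
Proof.
have E : \sum_i Int (dpsi i) = 0 by apply: big1 => i _; exact: Int_dpsi.
move: E; rewrite -Int_sum; last by move=> i; exact: CcD (c12 i) (c3 i).
have cs3 := Cc_sum c3; have cs12 := Cc_sum c12.
rewrite (eqInt (g := fun x => (\sum_i (F1 (P x) * phi x * q i x ^+ 2 + F (P x) * (dphi i x * q i x))) +
   \sum_i F (P x) * phi x * ddmoll r f i x)); last by move=> x; rewrite -big_split.
rewrite IntD// => /eqP; rewrite addr_eq0 => /eqP ->; rewrite oppr_ge0 -[leRHS](Int0 R n).
apply: Int_le => //; first exact: Cc0.
move=> x; rewrite -mulr_sumr.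
have [Ax|nAx] := pselect (A x); last by rewrite phiA// mulr0 mul0r.
have /andP[FP0 _] := F0 (Pm x).
apply: mulr_ge0_le0; first exact: mulr_ge0.
apply: (moll_superharmonic r0 continuous_trunc sh) => y yx.
(* Around a point of [A] the ball of radius [r] stays where [d] is at least [m], hence inside [Om]
   and where [trunc] is [d]. *)
have ym : enorm (y - x) <= 3 * m by move: yx rm m0; lra.
have := near_d Ax ym; rewrite subrKC => -[e1 e2]; split=> //.
by apply: (distc_gt0_in OmT); apply: lt_le_trans e2.
Qed.

(** The factor of [E i] in [chain_rule_bound]. *)
Let W i x : R := 2 * phi x + `|dphi i x|.

Let Wc i : Cc (W i) := CcD (CcZ 2 phic) (Cc_norm (dphic i)).

Let fshc v : continuous (fun x => f (x + v)).
Proof. exact: (@continuous_shiftr _ _ f v continuous_trunc). Qed.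

Let errc i : continuous (err i).
Proof.
rewrite (_ : err i = fun x =>
  (f x + f x - f (x + h *: dir i) - f (x + - (h *: dir i))) * h^-1 + 2 * slack).
  apply: (continuous_addf (g := fun=> 2 * slack)); last exact: cst_continuous.
  apply: (continuous_mulf (g := fun=> h^-1)); last exact: cst_continuous.
  apply: continuous_subf => //; apply: continuous_subf => //.
  by apply: continuous_addf; exact: continuous_trunc.
by apply/funext => x; rewrite /err; congr (_ * _ + _); ring.
Qed.

(** Summation by parts. Translating the backward difference by [h e_i] makes it a forward difference
    with translated weight, so only the increment of [W] remains, multiplied by a difference of [f].
    The latter is at most [h] by the Lipschitz bound and cancels the division by [h]. *)
Lemma Int_err i : Int (fun x => W i x * err i x) <=
  Int (fun x => `|W i (x + h *: dir i) - W i x|) + 2 * slack * Int (W i).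
Proof.
pose e := h *: dir i.
have cW v : Cc (fun x => W i (x + v)) := Cc_shift v (@Wc i).
have cWf v : Cc (fun x => W i x * f (x + v)) := CcM (@Wc i) (@fshc v).
have cWf0 : Cc (fun x => W i x * f x) := CcM (@Wc i) continuous_trunc.
have cWsf v : Cc (fun x => W i (x + e) * f (x + v)) := CcM (cW e) (@fshc v).
have cWsf0 : Cc (fun x => W i (x + e) * f x) := CcM (cW e) continuous_trunc.
have cD := CcB (cW e) (@Wc i).
have E1 : Int (fun x => W i x * (f x - f (x - e))) = Int (fun x => W i (x + e) * (f (x + e) - f x)).
  rewrite -(Int_shift (f := fun x => W i x * (f x - f (x - e))) e).
    by apply: eqInt => x; rewrite addrK.
  by apply: eqCc (CcB cWf0 (cWf (- e))) => x; rewrite mulrBr.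
have E : Int (fun x => W i x * err i x) =
    h^-1 * Int (fun x => (W i (x + e) - W i x) * (f (x + e) - f x)) + 2 * slack * Int (W i).
  have cT1 : Cc (fun x => W i x * (f x - f (x - e))).
    by apply: eqCc (CcB cWf0 (cWf (- e))) => x; rewrite mulrBr.
  have cT2 : Cc (fun x => W i x * (f (x + e) - f x)).
    by apply: eqCc (CcB (cWf e) cWf0) => x; rewrite mulrBr.
  have cT3 : Cc (fun x => W i (x + e) * (f (x + e) - f x)).
    by apply: eqCc (CcB (cWsf e) cWsf0) => x; rewrite mulrBr.
  rewrite (eqInt (g := fun x => h^-1 * (W i x * (f x - f (x - e)) - W i x * (f (x + e) - f x)) +
      2 * slack * W i x)); last by move=> x; rewrite /err; ring.
  rewrite IntD ?IntZ ?IntB//; [|exact: CcB|exact: CcZ (CcB _ _)|exact: CcZ].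
  rewrite E1 -IntB//; congr (_ * _ + _); apply: eqInt => x; ring.
rewrite E lerD2r ler_pdivrMl// -IntZ; last exact: Cc_norm.
apply: Int_le.
- by apply: CcM => //; apply: continuous_subf => //; exact: continuous_trunc.
- exact/CcZ/Cc_norm.
move=> x; apply: le_trans (ler_norm _) _; rewrite normrM mulrC ler_wpM2r//.
apply: le_trans (lip_norm trunc_lip _ _) _.
by rewrite addrAC subrr add0r enorm_hdir gtr0_norm.
Qed.

Lemma Cc_enorm_grad : Cc (fun x => enorm (grad x)).
Proof.
have [K K0 sK] := Cc_sum (fun i => CcM (dphic i) (Cc_continuous (dphic i))).
have E x : enorm (grad x) = Num.sqrt (\sum_i dphi i x * dphi i x).
  by congr Num.sqrt; apply: eq_bigr => i _; rewrite mxE.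
exists K => //; split=> [x|x i xi]; last by rewrite E (sK.2 x i)// sqrtr0.
rewrite (_ : (fun _ => _) = fun x => Num.sqrt (\sum_i dphi i x * dphi i x)); last exact/funext.
exact: (cvg_comp _ _ (sK.1 x) (@sqrt_continuous R _)).
Qed.

(** [chain_rule_bound] is integrated and combined with [superharmonic_test]. The error tends to zero
    when [h] does, provided that [r] is negligible against [h], because [slack] contains [r / h]. *)
Lemma step_inequality :
  Int (fun x => - F1 (P x) * phi x) <= Int (fun x => F (P x) * enorm (grad x)) +
   M * \sum_i (Int (fun x => `|W i (x + h *: dir i) - W i x|) + 2 * slack * Int (W i)).
Proof.
have cWe i : Cc (fun x => W i x * err i x) := CcM (@Wc i) (@errc i).
have ca : Cc (fun x => F1 (P x) * phi x).
  by apply: eqCc (CcM phic F1Pc) => x; rewrite mulrC.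
have cg : Cc (fun x => F (P x) * enorm (grad x)).
  by apply: eqCc (CcM Cc_enorm_grad FPc) => x; rewrite mulrC.
have cS := Cc_sum cWe.
have H : 0 <= Int (fun x => F1 (P x) * phi x + F (P x) * enorm (grad x) +
    M * \sum_i W i x * err i x).
  apply: le_trans superharmonic_test _; apply: Int_le.
  - exact: Cc_sum c12.
  - by apply: CcD; [exact: CcD|exact: CcZ].
  move=> x; have /andP[FP0 FPM] := F0 (Pm x); have /andP[F1P0 F1PM] := F10 (Pm x).
  have [Ax|nAx] := pselect (A x); last first.
    rewrite phiA// big1 => [|i _]; last by rewrite dphiA//; ring.
    rewrite big1 => [|i _]; last by rewrite /W phiA// dphiA// normr0; ring.
    by rewrite !mulr0 addr0 add0r mulr_ge0// enorm_ge0.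
  have [p p1 pq] := grad_moll_close Ax.
  have := @chain_rule_bound R n p (\row_i q i x) (grad x) (err^~ x) (- F1 (P x)) (F (P x)) (phi x) M p1.
  rewrite F1P0 F1PM FP0 FPM => /(_ isT isT (phi0 x)).
  have -> : - - F1 (P x) * phi x * sqn (\row_i0 q i0 x) + F (P x) * dot (grad x) (\row_i0 q i0 x) =
      \sum_i (F1 (P x) * phi x * q i x ^+ 2 + F (P x) * (dphi i x * q i x)).
    rewrite opprK /sqn /dot !mulr_sumr -big_split; apply: eq_bigr => i _ /=.
    by rewrite !mxE.
  have -> : - (- F1 (P x) * phi x) = F1 (P x) * phi x by rewrite mulNr opprK.
  have -> : \sum_i (2 * phi x + `|grad x ord0 i|) * err i x = \sum_i W i x * err i x.
    by apply: eq_bigr => i _; rewrite mxE.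
  apply=> i; rewrite mxE; last exact: pq.
  exact: (dmoll_le1 r0 continuous_trunc trunc_bound trunc_lip).
move: H; rewrite IntD//; [|exact: CcD|exact: CcZ].
rewrite IntD// IntZ// Int_sum// => H.
have -> : Int (fun x => - F1 (P x) * phi x) = - Int (fun x => F1 (P x) * phi x).
  by rewrite -mulN1r -IntZ//; apply: eqInt => x; ring.
have M0 : 0 <= M.
  have /andP[a b] := F0 (Pm 0); exact: le_trans a b.
have : M * \sum_i Int (fun x => W i x * err i x) <=
    M * \sum_i (Int (fun x => `|W i (x + h *: dir i) - W i x|) + 2 * slack * Int (W i)).
  by apply: ler_wpM2l => //; apply: ler_sum => i _; exact: Int_err.
move: H; lra.
Qed.

End Step.
End WeightedInequality.

(** * Removal of the mollification *)

Section Limit.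
Variables (R : realType) (n : nat).
Notation V := 'rV[R]_n.
Implicit Types (x y z v : V) (i j : 'I_n).
Notation dir i := (delta_mx ord0 i : 'rV[R]_n).

Lemma Int_ge0 (g : V -> R) : Cc g -> (forall x, 0 <= g x) -> 0 <= Int g.
Proof. by move=> cg g0; rewrite -[leLHS](Int0 R n); apply: Int_le => //; exact: Cc0. Qed.

(** The constant is the volume of a cube containing both supports for steps at most [1]. It is
    chosen before [e], so that the total error can later be normalised. *)
Lemma Int_shift_diff (g : V -> R) i : Cc g -> exists2 C : R, 0 <= C &
  forall e, 0 < e -> exists2 s, 0 < s & forall h, 0 < h -> h <= s ->
    Int (fun x => `|g (x + h *: dir i) - g x|) <= e * C.
Proof.
move=> [K K0 gK]; exists ((2 * (K + 1)) ^+ n).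
  by rewrite exprn_ge0// mulr_ge0// addr_ge0.
move=> e e0; have [s s0 H] := cc_unif K0 gK e0.
exists (Num.min (s / 2) 1) => [|h h0].
  by rewrite lt_min ltr01 divr_gt0.
rewrite le_min => /andP[hs h1].
apply: le_trans (ler_norm _) _; apply: Int_bound; first exact: addr_ge0.
  have g1 : cc (K + 1) (fun x => g (x + h *: dir i)).
    apply: cc_shift gK _ => j; apply: le_trans (norm_dir _ _ _) _.
    by rewrite gtr0_norm.
  have g2 : cc (K + 1) g by apply: cc_mono gK; rewrite lerDl.
  split=> [x|x j xj]; last by rewrite (g1.2 x j)// (g2.2 x j)// subrr normr0.
  exact: (cvg_norm (cvgB (g1.1 x) (g2.1 x))).
move=> x; rewrite normr_id; apply: H => j.
rewrite [(x + _) _ _]mxE addrAC subrr add0r.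
apply: le_lt_trans (norm_dir _ _ _) _; rewrite gtr0_norm//.
by apply: le_lt_trans hs _; rewrite ltr_pdivrMr// ltr_pMr// ltr1n.
Qed.

Variable (Om : set V).
Notation d := (distc Om).

Lemma weighted_inequality (Rd m : R) (phi : V -> R) (dphi : 'I_n -> V -> R)
    (A : set V) (F F1 : R -> R) (M : R) :
  Om != [set: V] -> neg_laplacian_nonneg Om d ->
  0 < m -> m <= Rd -> (forall x, d x <= Rd) ->
  Cc phi -> (forall x, 0 <= phi x) ->
  (forall i x, is_derive x (dir i) phi (dphi i x)) -> (forall i, Cc (dphi i)) ->
  (forall x, A x -> 4 * m <= d x) ->
  (forall x, ~ A x -> phi x = 0) -> (forall i x, ~ A x -> dphi i x = 0) ->
  (forall t, m <= t <= Rd -> is_derive t (1 : R) F (F1 t)) ->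
  (forall t, m <= t <= Rd -> {for t, continuous F1}) ->
  (forall t, m <= t <= Rd -> 0 <= F t <= M) ->
  (forall t, m <= t <= Rd -> 0 <= - F1 t <= M) ->
  Int (fun x => - F1 (trunc Om m x) * phi x) <=
  Int (fun x => F (trunc Om m x) * enorm (grad dphi x)).
Proof.
move=> OmT sh m0 mRd dRd phic phi0 dphiP dphic Ad phiA dphiA FP F1c F0 F10.
have M0 : 0 <= M.
  have := F0 m; rewrite lexx mRd => /(_ isT)/andP[a b]; exact: le_trans b.
pose W i x : R := 2 * phi x + `|dphi i x|.
have Wc i : Cc (W i) by apply: CcD; [exact: CcZ|exact: Cc_norm].
have W0 i x : 0 <= W i x by rewrite addr_ge0// mulr_ge0.
have Gc : Cc (fun x => enorm (grad dphi x)) := Cc_enorm_grad dphic.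
have G0 x : 0 <= enorm (grad dphi x) by exact: enorm_ge0.
have /choice[Cw CwP] : forall i, exists C : R, 0 <= C /\ forall e, 0 < e -> exists2 s, 0 < s &
    forall h, 0 < h -> h <= s -> Int (fun x => `|W i (x + h *: dir i) - W i x|) <= e * C.
  by move=> i; have [C ? ?] := Int_shift_diff i (Wc i); exists C.
(* The coefficients of [e] in the final error: replacing [F1(P)] costs [Int phi], replacing [F(P)]
   costs the integral of [|grad phi|], and the step inequality costs the last sum, in which [4]
   arises from [2 * sl] with [sl <= 2 * e]. *)
pose B := Int phi + Int (fun x => enorm (grad dphi x)) + M * \sum_i (Cw i + 4 * Int (W i)).
have B0 : 0 <= B.
  rewrite !addr_ge0 ?Int_ge0// mulr_ge0// sumr_ge0// => i _.
  by rewrite addr_ge0 ?(CwP i).1// mulr_ge0// Int_ge0.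
apply/ler_addgt0Pl => e' e'0; pose e := e' / (B + 1).
have B10 : 0 < B + 1 by rewrite ltr_wpDl.
have e0 : 0 < e by exact: divr_gt0.
have cF t : `[m, Rd]%classic t -> {for t, continuous F}.
  rewrite /= in_itv/= => /FP dF.
  by apply/differentiable_continuous/derivable1_diffP; have [] := dF.
have cF1 t : `[m, Rd]%classic t -> {for t, continuous F1}.
  by rewrite /= in_itv/= => /F1c.
have [s1 s10 H1] := compact_unif_continuous (@segment_compact _ m Rd) cF e0.
have [s2 s20 H2] := compact_unif_continuous (@segment_compact _ m Rd) cF1 e0.
have [s s0 Hs] : exists2 s, 0 < s & forall i h, 0 < h -> h <= s ->
    Int (fun x => `|W i (x + h *: dir i) - W i x|) <= e * Cw i.
  apply: (@finite_pos_bound R n (fun i s => forall h, 0 < h -> h <= s ->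
    Int (fun x => `|W i (x + h *: dir i) - W i x|) <= e * Cw i)).
    by move=> i; have [_ /(_ e e0)] := CwP i.
  by move=> i a b b0 ba H h h0 hb; apply: H => //; exact: le_trans ba.
(* The entry [2 * m * e] gives [h ^+ 2 / (2 * m) <= h * e]. *)
pose h := Num.min s (Num.min m (2 * m * e)).
have me0 : 0 < 2 * m * e by apply: mulr_gt0 => //; exact: mulr_gt0.
have h0 : 0 < h by rewrite !lt_min s0 m0 me0.
have hs : h <= s by rewrite ge_min lexx.
have hm : h <= m by rewrite !ge_min lexx orbT.
have hme : h <= 2 * m * e by rewrite !ge_min lexx !orbT.
(* Chosen after [h]: the entry [h * e / 2] gives [2 * r <= h * e], hence [sl <= 2 * e]; the last two
   put [P] within the moduli of continuity of [F] and [F1]. *)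
pose r := Num.min (Num.min m (h * e / 2)) (Num.min (s1 / 2) (s2 / 2)).
have he0 : 0 < h * e / 2 by apply: divr_gt0 => //; exact: mulr_gt0.
have r0 : 0 < r.
  by rewrite !lt_min m0 he0 (divr_gt0 s10 (ltr0n R 2)) (divr_gt0 s20 (ltr0n R 2)).
have rm : r <= m by rewrite !ge_min lexx.
have rhe : 2 * r <= h * e.
  rewrite mulrC -ler_pdivlMr//; by rewrite !ge_min lexx !orbT.
have half (x : R) : 0 < x -> x / 2 < x.
  by move=> x0; rewrite ltr_pdivrMr// ltr_pMr// ltr1n.
have rs1 : r < s1 by rewrite !gt_min (half _ s10) !orbT.
have rs2 : r < s2 by rewrite !gt_min (half _ s20) !orbT.
have ft : continuous (trunc Om m) by exact: continuous_trunc.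
have fm x : m <= trunc Om m x <= Rd by rewrite trunc_ge trunc_le.
have fb := trunc_bound m0 mRd dRd.
have Pm x : m <= moll r (trunc Om m) x <= Rd.
  apply/andP; split; [apply: moll_ge => //|apply: moll_le => //] => y.
    by have /andP[] := fm y.
  by have /andP[] := fm y.
have Pf x : `|trunc Om m x - moll r (trunc Om m) x| <= r.
  by rewrite distrC; exact: (moll_close r0 ft (trunc_lip OmT m)).
have PF x : `|F (trunc Om m x) - F (moll r (trunc Om m) x)| <= e.
  by apply: H1; rewrite /= ?in_itv//= -ball_normE /ball_/=; exact: le_lt_trans rs1.
have PF1 x : `|F1 (trunc Om m x) - F1 (moll r (trunc Om m) x)| <= e.
  by apply: H2; rewrite /= ?in_itv//= -ball_normE /ball_/=; exact: le_lt_trans rs2.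
have compc (g : V -> R) (k : R -> R) : (forall t, `[m, Rd]%classic t -> {for t, continuous k}) ->
    continuous g -> (forall x, m <= g x <= Rd) -> continuous (fun x => k (g x)).
  move=> ck cg gm x; have ckg : {for g x, continuous k} by apply: ck; rewrite /= in_itv/=.
  exact: (cvg_comp _ _ (cg x) ckg).
have Pc : continuous (moll r (trunc Om m)) by exact: (@continuous_moll R n r r0 (trunc Om m) Rd ft fb).
have cFf := compc _ _ cF ft fm; have cFP := compc _ _ cF Pc Pm.
have cF1f := compc _ _ cF1 ft fm; have cF1P := compc _ _ cF1 Pc Pm.
have step := step_inequality OmT sh m0 mRd dRd phic phi0 dphiP dphic Ad phiA dphiA
  FP F1c F0 F10 r0 rm h0 hm.
have Cl (k : V -> R) (g : V -> R) : continuous k -> Cc g -> Cc (fun x => k x * g x).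
  by move=> ck cg; apply: eqCc (CcM cg ck) => x; rewrite mulrC.
have Nc (k : V -> R) : continuous k -> continuous (fun x => - k x).
  by move=> ck x; exact: (cvgN (ck x)).
have L : Int (fun x => - F1 (trunc Om m x) * phi x) <=
    Int (fun x => - F1 (moll r (trunc Om m) x) * phi x) + e * Int phi.
  rewrite -IntZ// -IntD; [|exact: Cl (Nc _ _) _|exact: CcZ].
  apply: Int_le; [exact: Cl (Nc _ _) _|apply: CcD; [exact: Cl (Nc _ _) _|exact: CcZ]|].
  move=> x; rewrite -mulrDl ler_wpM2r//.
  by have := PF1 x; rewrite ler_norml => /andP[]; lra.
have Rr : Int (fun x => F (moll r (trunc Om m) x) * enorm (grad dphi x)) <=
    Int (fun x => F (trunc Om m x) * enorm (grad dphi x)) + e * Int (fun x => enorm (grad dphi x)).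
  rewrite -IntZ// -IntD; [|exact: Cl|exact: CcZ].
  apply: Int_le; [exact: Cl|apply: CcD; [exact: Cl|exact: CcZ]|].
  move=> x; rewrite -mulrDl ler_wpM2r//.
  by have := PF x; rewrite ler_norml => /andP[]; lra.
set sl := (2 * r + h ^+ 2 / (2 * m)) / h in step.
have sle : sl <= 2 * e.
  rewrite ler_pdivrMr//.
  have : h ^+ 2 / (2 * m) <= h * e.
    by rewrite ler_pdivrMr ?mulr_gt0// expr2 -mulrA ler_pM2l// mulrC.
  by move: rhe; lra.
have S : \sum_i (Int (fun x => `|W i (x + h *: dir i) - W i x|) + 2 * sl * Int (W i)) <=
    e * \sum_i (Cw i + 4 * Int (W i)).
  rewrite mulr_sumr; apply: ler_sum => i _; rewrite mulrDr; apply: lerD; first exact: Hs.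
  rewrite (mulrA e); apply: ler_wpM2r; first exact: Int_ge0.
  move: sle; lra.
have {}S := ler_wpM2l M0 S.
have Ee : e * (B + 1) = e' by rewrite divfK// gt_eqF.
move: L Rr step S; rewrite -Ee /B.
set a1 := Int _; set a2 := Int _; set a3 := Int _; set a4 := Int _; set a5 := Int _; set a6 := Int _.
by lra.
Qed.

End Limit.

(** * The weight and the test functions *)

Section Weight.
Variables (R : realType) (s gamma Rd : R).
Hypotheses (s1 : 1 <= s) (g1 : 1 < gamma) (Rd0 : 0 < Rd).

Definition weight (t : R) : R :=
  t `^ (1 - s) - Rd `^ (1 - s) * Xfun (t / Rd) `^ (gamma - 1).

Definition dweight (t : R) : R :=
  (1 - s) * t `^ (- s) -
  Rd `^ (1 - s) * ((gamma - 1) * (Xfun (t / Rd) `^ gamma / t)).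

Lemma Xden_ge1 t : t <= Rd -> 1 <= 1 - ln (t / Rd).
Proof. by move=> tR; rewrite lerDl oppr_ge0 ln_le0// ler_pdivrMr// mul1r. Qed.

Lemma Xfun_gt0 t : t <= Rd -> 0 < Xfun (t / Rd).
Proof. by move=> tR; rewrite invr_gt0 (lt_le_trans ltr01)// Xden_ge1. Qed.

Lemma Xfun_le1 t : t <= Rd -> Xfun (t / Rd) <= 1.
Proof. by move=> tR; rewrite invf_le1 ?Xden_ge1// (lt_le_trans ltr01)// Xden_ge1. Qed.

(** The identity behind the constant: the chain rule turns it into the derivative
    [(gamma - 1) X^gamma / t] of [X^(gamma - 1)]. *)
Lemma is_derive_Xfun t : 0 < t <= Rd ->
  is_derive t (1 : R) (fun t => Xfun (t / Rd)) (Xfun (t / Rd) ^+ 2 / t).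
Proof.
move=> /andP[t0 tR]; have tRd0 : 0 < t / Rd by exact: divr_gt0.
have D0 : 1 - ln (t / Rd) != 0 by rewrite gt_eqF// (lt_le_trans ltr01)// Xden_ge1.
have d1 : is_derive t (1 : R) (fun t : R => t * Rd^-1) Rd^-1.
  apply: is_derive_eq (is_derive_mulf (is_derive_id t (1 : R)) (is_derive_cstf t _ Rd^-1)) _.
  by rewrite mulr0 add0r mulr1.
have d2 := is_derive_comp (f := fun t : R => t * Rd^-1) d1 (is_derive1_ln tRd0).
have d3 : is_derive t (1 : R) (fun t : R => 1 - ln (t / Rd)) (- t^-1).
  apply: is_derive_eq (is_deriveB (is_derive_cstf t (1 : R) 1) d2) _.
  by rewrite sub0r invfM invrK mulfK// gt_eqF.
apply: is_derive_eq (is_deriveV (f := fun t : R => 1 - ln (t / Rd)) D0 d3) _.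
by rewrite /Xfun exprVn /GRing.scale/= mulrNN.
Qed.

Lemma is_derive_weight t : 0 < t <= Rd -> is_derive t (1 : R) weight (dweight t).
Proof.
move=> tR; have /andP[t0 tRd] := tR; have X0 := Xfun_gt0 tRd.
have d1 := is_derive1_powR (1 - s) t0.
have d2 := is_derive_comp (is_derive_Xfun tR) (is_derive1_powR (gamma - 1) X0).
have d3 := is_derive_mulf (is_derive_cstf t (1 : R) (Rd `^ (1 - s))) d2.
apply: is_derive_eq (is_deriveB d1 d3) _.
rewrite /dweight (_ : 1 - s - 1 = - s); last by ring.
rewrite mulr0 addr0; congr (_ - _ * _); rewrite -mulrA; congr (_ * _).
rewrite mulrA; congr (_ / _).
have -> : Xfun (t / Rd) ^+ 2 = Xfun (t / Rd) `^ 2 by rewrite powR_mulrn// ltW.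
rewrite -powRD; last by apply/implyP => _; rewrite gt_eqF.
by congr (_ `^ _); ring.
Qed.

Lemma continuous_dweight t : 0 < t <= Rd -> {for t, continuous dweight}.
Proof.
move=> tR; have /andP[t0 tRd] := tR; have X0 := Xfun_gt0 tRd.
have d1 := is_derive1_powR (- s) t0.
have d2 := is_derive_comp (is_derive_Xfun tR) (is_derive1_powR gamma X0).
have d3 := is_deriveV (f := id) (lt0r_neq0 t0) (is_derive_id t (1 : R)).
have d4 := is_derive_mulf (is_derive_cstf t (1 : R) (1 - s)) d1.
have d5 := is_derive_mulf (is_derive_cstf t (1 : R) (gamma - 1)) (is_derive_mulf d2 d3).
have d6 := is_derive_mulf (is_derive_cstf t (1 : R) (Rd `^ (1 - s))) d5.
apply/differentiable_continuous/derivable1_diffP.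
by have [] := is_deriveB d4 d6.
Qed.

Lemma weight_le t : t <= Rd -> weight t <= t `^ (1 - s).
Proof. by move=> tR; rewrite gerBl mulr_ge0// powR_ge0. Qed.

(** Both terms are compared with [Rd^(1-s)]: the subtracted one is at most this since [X <= 1], and
    [t^(1-s)] is at least this since [t <= Rd] and [s >= 1]. *)
Lemma weight_ge0 t : 0 < t <= Rd -> 0 <= weight t.
Proof.
move=> /andP[t0 tR]; rewrite subr_ge0; apply: (@le_trans _ _ (Rd `^ (1 - s))).
  rewrite ler_piMr ?powR_ge0//.
  rewrite -[leRHS](powRr0 (Xfun (t / Rd))); apply: ger_powR; last by rewrite subr_ge0 ltW.
  by rewrite Xfun_gt0//= Xfun_le1.
rewrite -(opprB s 1) !powRN lef_pV2 ?posrE ?powR_gt0//.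
by apply: ge0_ler_powR; rewrite ?nnegrE ?subr_ge0// ltW.
Qed.

Lemma dweight_ge0 t : 0 < t <= Rd -> 0 <= - dweight t.
Proof.
move=> /andP[t0 tR]; rewrite opprB -mulNr opprB; apply: addr_ge0.
  apply: mulr_ge0; first exact: powR_ge0.
  apply: mulr_ge0; first by rewrite subr_ge0 ltW.
  by rewrite divr_ge0 ?powR_ge0// ltW.
by rewrite mulr_ge0 ?powR_ge0// subr_ge0.
Qed.

End Weight.

(** * From nonnegative differentiable test functions to [|u|] *)

Section Abs.
Variables (R : realType) (n : nat) (Om : set 'rV[R]_n).
Notation V := 'rV[R]_n.
Notation dir i := (delta_mx ord0 i : 'rV[R]_n).
Notation d := (distc Om).

Lemma segment_ubound (k : R -> R) (a b : R) : a <= b ->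
  (forall t, a <= t <= b -> {for t, continuous k}) ->
  exists M, forall t, a <= t <= b -> k t <= M.
Proof.
move=> ab ck; have [|c _ H] := @EVT_max R k a b ab.
  apply: continuous_in_subspaceT => t; rewrite inE/= in_itv/=; exact: ck.
by exists (k c) => t tab; apply: H; rewrite in_itv/=.
Qed.

(* The weighted inequality tested with [sqrt (u ^ 2 + e ^ 2) - e], which lies
   between [|u| - e] and [|u|] and has a gradient no longer than that of [u]. *)
Lemma weighted_inequality_abs (Rd m : R) (u : V -> R) (du : 'I_n -> V -> R)
    (A : set V) (F F1 : R -> R) :
  Om != [set: V] -> neg_laplacian_nonneg Om d ->
  0 < m -> m <= Rd -> (forall x, d x <= Rd) ->
  Cc u ->
  (forall i x, is_derive x (dir i) u (du i x)) -> (forall i, Cc (du i)) ->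
  (forall x, A x -> 4 * m <= d x) ->
  (forall x, ~ A x -> u x = 0) -> (forall i x, ~ A x -> du i x = 0) ->
  (forall t, m <= t <= Rd -> is_derive t (1 : R) F (F1 t)) ->
  (forall t, m <= t <= Rd -> {for t, continuous F1}) ->
  (forall t, m <= t <= Rd -> 0 <= F t) ->
  (forall t, m <= t <= Rd -> 0 <= - F1 t) ->
  Int (fun x => - F1 (trunc Om m x) * `|u x|) <=
  Int (fun x => F (trunc Om m x) * enorm (grad du x)).
Proof.
move=> OmT sh m0 mRd dRd uc duP duc Ad uA duA FP F1c F0 F10.
have cF t : m <= t <= Rd -> {for t, continuous F}.
  move=> /FP dF.
  by apply/differentiable_continuous/derivable1_diffP; have [] := dF.
have cNF1 t : m <= t <= Rd -> {for t, continuous (fun t => - F1 t)}.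
  by move=> /F1c c; exact: (cvgN c).
have [M1 HM1] := segment_ubound mRd cF.
have [M2 HM2] := segment_ubound mRd cNF1.
pose M := Num.max M1 M2.
have F0M t : m <= t <= Rd -> 0 <= F t <= M.
  by move=> tm; rewrite F0//= le_max HM1.
have F10M t : m <= t <= Rd -> 0 <= - F1 t <= M.
  by move=> tm; rewrite F10//= le_max HM2// orbT.
have ft : continuous (trunc Om m) by exact: continuous_trunc.
have fm x : m <= trunc Om m x <= Rd by rewrite trunc_ge trunc_le.
have M0 : 0 <= M.
  by have /andP[a b] := F0M _ (fm 0); exact: le_trans b.
have cFf : continuous (fun x => F (trunc Om m x)).
  by move=> x; exact: (cvg_comp _ _ (ft x) (cF _ (fm x))).
have cF1f : continuous (fun x => - F1 (trunc Om m x)).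
  by move=> x; exact: (cvg_comp _ _ (ft x) (cNF1 _ (fm x))).
have Cl (k : V -> R) (g : V -> R) : continuous k -> Cc g -> Cc (fun x => k x * g x).
  by move=> ck cg; apply: eqCc (CcM cg ck) => x; rewrite mulrC.
have [K K0 uK] := uc.
apply/ler_addgt0Pl => e' e'0.
(* Smoothing [|u|] changes the left integrand by at most [M * e], inside a cube of volume
   [(2 * K) ^+ n]. *)
pose B := M * (2 * K) ^+ n + 1.
have B0 : 0 < B by rewrite ltr_wpDl// mulr_ge0// exprn_ge0// mulr_ge0.
pose e := e' / B; have e0 : 0 < e by exact: divr_gt0.
pose S x := Num.sqrt (u x ^+ 2 + e ^+ 2).
have T0 x : 0 < u x ^+ 2 + e ^+ 2 by rewrite ltr_wpDl ?sqr_ge0// exprn_gt0.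
have S0 x : 0 < S x by rewrite sqrtr_gt0.
have S2 x : S x ^+ 2 = u x ^+ 2 + e ^+ 2 by rewrite sqr_sqrtr// ltW.
have uS x : `|u x| <= S x by rewrite -sqrtr_sqr ler_wsqrtr// lerDl sqr_ge0.
have eS x : e <= S x by rewrite -[leLHS]gtr0_norm// -sqrtr_sqr ler_wsqrtr// lerDr sqr_ge0.
have Su x : S x <= `|u x| + e.
  rewrite -(@ler_pXn2r _ 2) ?nnegrE ?addr_ge0 ?(ltW e0) ?(ltW (S0 x))// S2 sqrrD real_normK ?num_real//.
  by have := mulr_ge0 (normr_ge0 (u x)) (ltW e0); lra.
have uct : continuous u := Cc_continuous uc.
have Sc : continuous S.
  have c2 : continuous (fun x => u x ^+ 2 + e ^+ 2).
    apply: (continuous_addf (g := fun=> e ^+ 2)); last exact: cst_continuous.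
    exact: continuous_mulf.
  by move=> x; exact: (cvg_comp _ _ (c2 x) (@sqrt_continuous R _)).
pose phi x := S x - e.
pose dphi i x := du i x * (u x / S x).
have SiVc : continuous (fun x => u x / S x).
  apply: (continuous_mulf (g := fun x => (S x)^-1)) => // x.
  exact: (cvgV (lt0r_neq0 (S0 x)) (Sc x)).
have phic : Cc phi.
  exists K => //; split=> [|x i xi].
    by apply: (continuous_subf (g := fun=> e)) => //; exact: cst_continuous.
  by rewrite /phi /S (uK.2 x i)// expr0n add0r sqrtr_sqr gtr0_norm// subrr.
have phi0 x : 0 <= phi x by rewrite subr_ge0.
have dphic i : Cc (dphi i) by exact: CcM.
have dphiP i x : is_derive x (dir i) phi (dphi i x).
  have d2 : is_derive x (dir i) (fun x => u x ^+ 2 + e ^+ 2) (2 * u x * du i x).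
    apply: is_derive_eq (is_derive_addf (is_derive_exp 2 (duP i x)) (is_derive_cstf x _ (e ^+ 2))) _.
    by rewrite addr0.
  have dS := is_derive_comp d2 (is_derive1_sqrt (T0 x)).
  apply: is_derive_eq (is_derive_addf dS (is_derive_cstf x _ (- e))) _.
  rewrite addr0 -/(S x) /dphi; field; exact: lt0r_neq0.
have phiA x : ~ A x -> phi x = 0.
  by move=> /uA ux; rewrite /phi /S ux expr0n add0r sqrtr_sqr gtr0_norm// subrr.
have dphiA i x : ~ A x -> dphi i x = 0 by move=> nAx; rewrite /dphi duA// mul0r.
have main := weighted_inequality OmT sh m0 mRd dRd phic phi0 dphiP dphic Ad phiA dphiA
  FP F1c F0M F10M.
have gl x : enorm (grad dphi x) <= enorm (grad du x).
  have -> : grad dphi x = (u x / S x) *: grad du x.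
    by apply/rowP => i; rewrite !mxE mulrC.
  rewrite enormZ ler_piMl ?enorm_ge0// normrM normfV (gtr0_norm (S0 x)).
  by rewrite ler_pdivrMr// mul1r.
have L : Int (fun x => - F1 (trunc Om m x) * `|u x|) <= Int (fun x => - F1 (trunc Om m x) * phi x) + e'.
  rewrite -lerBlDl -IntB; [|exact: Cl (Cc_norm _)|exact: Cl].
  apply: le_trans (ler_norm _) _.
  have ee : e * (M * (2 * K) ^+ n) <= e'.
    by rewrite -[leRHS](divfK (lt0r_neq0 B0)) ler_pM2l// lerDl.
  apply: le_trans ee; rewrite mulrA; apply: Int_bound => //.
    split=> [x|x i xi].
      apply: (@continuous_subf R n (fun x => - F1 (trunc Om m x) * `|u x|) (fun x => - F1 (trunc Om m x) * phi x)).
        by apply: Cc_continuous; exact: Cl (Cc_norm _).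
      by apply: Cc_continuous; exact: Cl.
    rewrite /phi /S (uK.2 x i)// normr0 expr0n add0r sqrtr_sqr gtr0_norm// subrr.
    by rewrite !mulr0 subrr.
  move=> x; rewrite -mulrBr normrM mulrC; have /andP[a b] := F10M _ (fm x).
  apply: ler_pM => //; last by rewrite ger0_norm.
  by rewrite ler_norml /phi; have := Su x; have := uS x; move: e0 => *; apply/andP; split; lra.
apply: le_trans L _; rewrite addrC lerD2l; apply: le_trans main _.
apply: Int_le; [exact: Cl (Cc_enorm_grad _)|exact: Cl (Cc_enorm_grad _)|].
by move=> x; apply: ler_wpM2l (gl x); exact: F0.
Qed.

End Abs.

(** * The inequality *)

(** The integrands of the statement are singular at the boundary of [Om]; each is matched with a
    globally continuous representative that agrees with it on [Om] and vanishes outside. *)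
Lemma intRn_restrict (R : realType) n (Om : set 'rV[R]_n) (g h : 'rV[R]_n -> R) :
  (forall x, Om x -> g x = h x) -> (forall x, ~ Om x -> h x = 0) -> Cc h ->
  intRn (fun x => if x \in Om then (g x)%:E else 0%E) = (Int h)%:E.
Proof.
move=> gh h0 hc; rewrite -intRn_Cc//; congr intRn; apply/funext => x.
by case: ifPn => [/set_mem/gh ->|/negP xOm] //; rewrite h0// => /mem_set.
Qed.

Lemma coord_le_norm (R : realType) n (x : 'rV[R]_n) i : `|x ord0 i| <= `|x|.
Proof.
rewrite [leRHS]/Num.norm/= mx_normrE.
by apply: (le_bigmax _ (fun ij : 'I_1 * 'I_n => `|x ij.1 ij.2|) (ord0, i)).
Qed.

Theorem theorem2p11 (R : realType) (n : nat) (Om : set 'rV[R]_n) :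
  open Om -> Om != [set: 'rV[R]_n] ->
  neg_laplacian_nonneg Om (distc Om) ->
  has_ubound [set distc Om x | x in Om] ->
  let d := distc Om in
  let Rd := sup [set d x | x in Om] in
  forall (s gamma : R), 1 <= s -> 1 < gamma ->
  exists C : R, gamma - 1 <= C /\
  forall u : 'rV[R]_n -> R, Cc_infty Om u ->
    (intRn (fun x => if x \in Om then (gradnorm u x / d x `^ (s - 1))%:E else 0)
     >= (s - 1)%:E * intRn (fun x => if x \in Om then (`|u x| / d x `^ s)%:E else 0)
        + (C / Rd `^ (s - 1))%:E *
          intRn (fun x => if x \in Om then
                   (`|u x| / d x * Xfun (d x / Rd) `^ gamma)%:E else 0))%E.
Proof.
move=> oOm OmT sh ub d Rd s gamma s1 g1; exists (gamma - 1); split=> // u [su [cS SOm]].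
(* For empty [Om] the value of [Rd] says nothing, but all three integrals are zero. Otherwise a
   point of [Om] makes [Rd] positive. *)
have [Om0|/set0P[x0 Ox0]] := eqVneq Om set0.
  rewrite !(@intRn_restrict _ _ _ _ (fun=> 0)) ?(Int0 R n); try exact: Cc0;
    try (by move=> x; rewrite Om0); try by [].
  by rewrite !mule0 adde0.
set S := closure _ in cS SOm.
have hs : has_sup [set d x | x in Om] by split=> //; exists (d x0), x0.
have d0 x : 0 <= d x by exact: distc_ge0.
have dRd x : d x <= Rd.
  have [Ox|nOx] := pselect (Om x); first by apply: sup_upper_bound => //; exists x.
  apply: (@le_trans _ _ 0); last first.
    by apply: le_trans (d0 x0) _; apply: sup_upper_bound => //; exists x0.
  by have := distc_le OmT x nOx; rewrite subrr enorm0.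
have dpos x : Om x -> 0 < d x by exact: distc_gt0.
have Rd0 : 0 < Rd := lt_le_trans (dpos _ Ox0) (dRd x0).
have cd : continuous d.
  (* Truncation at level [0] leaves the nonnegative function [d] unchanged. *)
  have -> : d = trunc Om 0 by apply/funext => x; rewrite /trunc; apply/esym/max_idPl.
  exact: continuous_trunc.
(* A quarter of the minimum of [d] over the compact support, capped by [Rd]; any admissible level,
   such as [Rd], does for an empty support. *)
have [m [m0 mRd Sm]] : exists m, [/\ 0 < m, m <= Rd & forall x, S x -> 4 * m <= d x].
  have [S0|/set0P Sn0] := eqVneq S set0.
    by exists Rd; split=> // x; rewrite S0.
  have [c cS' cmin] := compact_EVT_min Sn0 cS (continuous_subspaceT cd).
  have dc : 0 < d c by apply/dpos/SOm/set_mem.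
  have q0 : 0 < d c / 4 by exact: divr_gt0.
  exists (Num.min (d c / 4) Rd); split=> [||x Sx].
  - by rewrite lt_min q0.
  - by rewrite ge_min lexx orbT.
  - apply: le_trans (cmin x (mem_set Sx)).
    by rewrite mulrC -ler_pdivlMr// ge_min lexx.
have uS x : ~ S x -> u x = 0.
  by move=> nS; apply: contra_notP nS => /eqP ux; exact: subset_closure.
have [K K0 uK] : Cc u.
  have [M [_ HM]] := compact_bounded cS.
  have M1 : M < `|M| + 1 by have := ler_norm M; lra.
  exists (`|M| + 1); first exact: addr_ge0.
  split=> [|x i xi]; first exact: smooth_continuous.
  apply: uS => /(HM _ M1); apply/negP; rewrite -ltNge.
  exact: lt_le_trans xi (coord_le_norm _ _).
have uc : Cc u by exists K.
pose du i := partial i u.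
have duc i : Cc (du i) by exists K => //; exact: cc_partial.
have duP i x : is_derive x (delta_mx ord0 i : 'rV[R]_n) u (du i x).
  exact: (derivableP (@smooth_derivable R n u i x su)).
have oS : open (~` S) by apply/closed_openC/closed_closure.
have duS i x : ~ S x -> du i x = 0.
  by move=> nS; apply: (@partial_open0 R n (~` S) u i oS uS x nS).
have gE x : gradnorm u x = enorm (grad du x).
  by congr Num.sqrt; apply: eq_bigr => i _; rewrite mxE.
have gc : Cc (gradnorm u) by apply: eqCc (Cc_enorm_grad duc) => x; rewrite gE.
have gS x : ~ S x -> gradnorm u x = 0.
  move=> nS; rewrite /gradnorm big1 ?sqrtr0// => i _.
  by rewrite -/(du i x) duS// expr0n.
pose f := trunc Om m.
have fm x : m <= f x <= Rd by rewrite trunc_ge trunc_le.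
have pos t : m <= t <= Rd -> 0 < t <= Rd.
  by move=> /andP[mt ->]; rewrite (lt_le_trans m0).
have f0 x : 0 < f x by have /pos/andP[] := fm x.
have fS x : S x -> f x = d x.
  by move=> /Sm mx; apply: truncE; apply: le_trans mx; rewrite ler_peMl ?(ltW m0)// ler1n.
have fc : continuous f by exact: continuous_trunc.
have fcomp (k : R -> R) : (forall x, derivable k (f x) 1) -> continuous (fun x => k (f x)).
  move=> dk x; have ck : {for f x, continuous k}.
    by apply/differentiable_continuous/derivable1_diffP.
  exact: (cvg_comp _ _ (fc x) ck).
have cpow a : continuous (fun x => f x `^ a).
  by apply: (fcomp (fun t => t `^ a)) => x; have [] := is_derive1_powR a (f0 x).
have cX : continuous (fun x => Xfun (f x / Rd) `^ gamma).
  apply: (fcomp (fun t => Xfun (t / Rd) `^ gamma)) => x.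
  have X0 : 0 < Xfun (f x / Rd) by apply: Xfun_gt0 => //; have /andP[] := fm x.
  by have [] := is_derive_comp (is_derive_Xfun Rd0 (pos _ (fm x))) (is_derive1_powR gamma X0).
have wP t : m <= t <= Rd ->
    is_derive t (1 : R) (weight s gamma Rd) (dweight s gamma Rd t).
  by move=> /pos tm; exact: is_derive_weight.
have dwc t : m <= t <= Rd -> {for t, continuous (dweight s gamma Rd)}.
  by move=> /pos tm; exact: continuous_dweight.
have w0 t : m <= t <= Rd -> 0 <= weight s gamma Rd t.
  by move=> /pos tm; exact: weight_ge0.
have dw0 t : m <= t <= Rd -> 0 <= - dweight s gamma Rd t.
  by move=> /pos tm; exact: dweight_ge0.
have main := weighted_inequality_abs OmT sh m0 mRd dRd uc duP duc Sm uS duS wP dwc w0 dw0.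
have Na : Cc (fun x => `|u x|) := Cc_norm uc.
(* The representatives of the three integrands: [d] becomes [f], which agrees with it on the
   support, and quotients become negative powers, continuous in [f] because [f] is positive. *)
pose k1 x := gradnorm u x * f x `^ (- (s - 1)).
pose k2 x := `|u x| * f x `^ (- s).
pose k3 x := `|u x| * f x `^ (-1) * Xfun (f x / Rd) `^ gamma.
have k1c : Cc k1 by exact: CcM.
have k2c : Cc k2 by exact: CcM.
have k3c : Cc k3 by apply: CcM => //; exact: CcM.
have fOm (k : 'rV[R]_n -> R) (g : R -> R) x : (forall x, ~ S x -> k x = 0) ->
    k x * g (d x) = k x * g (f x).
  move=> kS; have [/fS ->//|nS] := pselect (S x).
  by rewrite kS// !mul0r.
have aS x : ~ S x -> `|u x| = 0 by move=> /uS ->; rewrite normr0.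
have SnOm x : ~ Om x -> ~ S x by apply: contra_not; exact: SOm.
rewrite (@intRn_restrict _ _ _ _ k2)//; last 2 first.
- by move=> x _; rewrite /k2 powRN; exact: (fOm _ (fun t => (t `^ s)^-1) x aS).
- by move=> x /SnOm nS; rewrite /k2 aS// mul0r.
rewrite (@intRn_restrict _ _ _ _ k3)//; last 2 first.
- move=> x _; rewrite /k3 powR_inv1 -?mulrA; last exact: ltW.
  exact: (fOm _ (fun t => t^-1 * Xfun (t / Rd) `^ gamma) x aS).
- by move=> x /SnOm nS; rewrite /k3 aS// !mul0r.
rewrite (@intRn_restrict _ _ _ _ k1)//; last 2 first.
- by move=> x _; rewrite /k1 powRN; exact: (fOm _ (fun t => (t `^ (s - 1))^-1) x gS).
- by move=> x /SnOm nS; rewrite /k1 gS// mul0r.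
rewrite -!EFinM -EFinD lee_fin -[X in _ + X]IntZ// -Int_lin//; last exact: CcZ.
(* The combination of [k2] and [k3] is exactly [- dweight(f) |u|], so [main] applies; the remaining
   comparison drops the subtracted term of [weight]. *)
apply: le_trans (_ : Int (fun x => weight s gamma Rd (f x) * enorm (grad du x)) <= _).
  apply: le_trans main; rewrite le_eqVlt; apply/orP; left; apply/eqP; apply: eqInt => x.
  rewrite /k2 /k3 /dweight powR_inv1; last exact: ltW.
  rewrite -(opprB s 1) !powRN; ring.
have wc : continuous (fun x => weight s gamma Rd (f x)).
  apply: fcomp => x.
  by have [] := wP _ (fm x).
apply: Int_le => //; first by apply: eqCc (CcM (Cc_enorm_grad duc) wc) => x; rewrite mulrC.
move=> x; rewrite /k1 gE mulrC ler_wpM2l ?enorm_ge0//.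
by rewrite opprB; apply: weight_le; have /andP[] := fm x.
Qed.
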